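(* Let $\alpha$ be a Young diagram with $n$ boxes and let $R_\alpha$ be the row tableau of shape $\alpha$. Then the maximal chain descent order $\mathcal Y(\alpha)_{\lambda_{R_\alpha}}(2)$ is isomorphic to Left order on $ST_\alpha$. Hence $\mathcal Y(\alpha)_{\lambda_{R_\alpha}}(2)$ is also isomorphic to (left) weak order on the generalized quotient $w(ST_\alpha)$ of the symmetric group $S_n$.
   Context: Young's lattice $\mathcal Y$ is the set of Young diagrams (integer partitions) ordered by containment, and $\mathcal Y(\alpha)=[\emptyset,\alpha]$. $ST_\alpha$ is the set of standard Young tableaux of shape $\alpha$ (bijective fillings of the boxes by $\{1,\dots,n\}$, increasing along rows left to right and down columns). The row tableau $R_\alpha$ is obtained by filling the first row by $1,\dots,\alpha_1$ from left to right, the second row by $\alpha_1+1,\dots,\alpha_1+\alpha_2$, and so on. For $T\in ST_\alpha$, the labeling $\lambda_T$ of $\mathcal Y(\alpha)$ labels a cover relation which adds the box $b$ of $\alpha$ by the entry $T(b)$; it is an EL-labeling. The $i$th tableau swap of $Q\in ST_\alpha$ is the filling obtained by exchanging the entries $i$ and $i+1$, provided it is standard. Left order on $ST_\alpha$ is the reflexive, transitive closure of the relation $Q<T$ if $T$ is the $i$th tableau swap of $Q$ for some $i$ and $i$ appears in a row above $i+1$ in $Q$. The row word $w(T)$ is the permutation (one-line notation) obtained by reading the rows of $T$ from left to right, top row first; $w(ST_\alpha)=\{w(T):T\in ST_\alpha\}$. For a Coxeter group $W$ with length function $\ell$ and $V\subseteq W$, the generalized quotient is $W/V=\{w\in W:\ell(wv)=\ell(w)+\ell(v)\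 \forall v\in V\}$; $w(ST_\alpha)$ is a generalized quotient of $S_n$ (a result of Björner and Wachs). Weak order on a generalized quotient is the restriction of the left weak order on $W$: $u\le w$ iff $w=s_{i_k}\cdots s_{i_1}u$ with the $s_{i_j}$ simple reflections and $\ell(s_{i_j}\cdots s_{i_1}u)=\ell(u)+j$ for $1\le j\le k$. For a finite poset $P$ with least element $\hat 0$ and greatest element $\hat 1$, $\mathcal M(P)$ is the set of maximal chains. For a chain $c$ and $x\in c$ write $c^x=\{w\in c: w\le x\}$, $c_x=\{w\in c: w\ge x\}$. A saturated chain gets the sequence of labels of its edges from bottom to top; it is ascending if this sequence is weakly increasing. An EL-labeling is a labeling of cover relations such that for every $x<y$ the interval $[x,y]$ has a unique ascending maximal chain and it lexicographically precedes all other maximal chains of $[x,y]$. A saturated chain $u\lessdot v\lessdot w$ is a descent if $\lambda(u,v)\not\le\lambda(v,w)$. Polygon move: $m\to m'$ if there are $x<z$ in $m\cap m'$ with $m^x=m'^x$, $m_z=m'_z$, such that $m'\cap[x,z]$ is a descent $x\lessdot y\lessdot z$ with $y\notin m$, while $m\cap[x,z]$ is the unique ascending maximal chain of $[x,z]$. The maximal chain descent order $P_\lambda(2)$ is $\mathcal M(P)$ partially ordered by the reflexive and transitive closure of $\to$. *)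

(* Defs.v *)
From HB Require Import structures.
From mathcomp Require Import all_boot all_order all_fingroup zify.

Set Implicit Arguments.
Unset Strict Implicit.
Unset Printing Implicit Defensive.

Import Order.TTheory.

Definition rel_isomorphic (A B : Type) (rA : A -> A -> Prop) (rB : B -> B -> Prop) : Prop :=
  exists2 f : A -> B, bijective f & forall x y, rA x y <-> rB (f x) (f y).

Section Chains.
Context {d : Order.disp_t} {P : finPOrderType d}.
Implicit Types (x y z : P) (c : {set P}).

Definition covers x y : bool := (x < y)%O && ~~ [exists z, (x < z < y)%O].

Definition chain c : bool := [forall x in c, forall y in c, (x >=< y)%O].

Definition itv x y : {set P} := [set w | (x <= w <= y)%O].

Definition maxchain x y c : bool :=
  maxset (fun c' : {set P} => chain c' && (c' \subset itv x y)) c.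

Definition chain_below c x : {set P} := [set w in c | (w <= x)%O].
Definition chain_above c x : {set P} := [set w in c | (x <= w)%O].

Context {d' : Order.disp_t} {L : porderType d'}.
(* Only the values of a labeling on cover relations are ever used. *)
Implicit Type lam : P -> P -> L.

Definition label_seq lam c : seq L :=
  if sort <=%O (enum c) is x :: s then pairmap lam x s else [::].

Definition ascending lam c : bool := sorted <=%O (label_seq lam c).

Definition is_EL lam : Prop :=
  forall x y, (x < y)%O ->
    exists c, [/\ maxchain x y c, ascending lam c,
      forall c', maxchain x y c' -> ascending lam c' -> c' = c
    & forall c', maxchain x y c' -> c' != c ->
        ((label_seq lam c : seqlexi L) < label_seq lam c')%O].

Definition descent lam x y z : bool :=
  [&& covers x y, covers y z & ~~ (lam x y <= lam y z)%O].

End Chains.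

Record EL_labeling d (P : finPOrderType d) d' (L : porderType d') := ELLabeling {
  EL_fun :> P -> P -> L;
  EL_funP : is_EL EL_fun }.

Section ChainTheory.
Context {d : Order.disp_t} {P : finPOrderType d}.
Implicit Types (x y z w : P) (c : {set P}) (s : seq P).

Lemma covers_lt x y : covers x y -> (x < y)%O. Proof. by case/andP. Qed.

Lemma covers_path_lt x s : path covers x s -> path <%O x s.
Proof. by apply: sub_path; exact: covers_lt. Qed.

Lemma covers_path_le x s : path covers x s -> path <=%O x s.
Proof. by apply: sub_path => y z /covers_lt/ltW. Qed.

Lemma covers_path_last x s : path covers x s -> (x <= last x s)%O.
Proof.
move=> /covers_path_le; elim: s x => //= z s IHs x /andP[xz /IHs]; exact: le_trans.
Qed.

Lemma covers_path_mem x s w :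
  path covers x s -> (x <= w <= last x s)%O ->
  {in x :: s, forall z, (z >=< w)%O} -> w \in x :: s.
Proof.
elim: s x => [|z s IHs] x /=; first by move=> _ /le_anti ->; rewrite inE.
move=> /andP[/andP[xz /existsPn ncov] zs] /andP[xw wl] cw.
have /orP[zw|wz] : (z >=< w)%O by apply: cw; rewrite !inE eqxx orbT.
  rewrite in_cons IHs ?orbT // ?zw // => u us; apply: cw; rewrite inE us orbT //.
have := ncov w; rewrite !lt_neqAle xw wz !andbT negb_and !negbK !inE => /orP[/eqP->|/eqP->];
  by rewrite eqxx ?orbT.
Qed.

Lemma chain_sorted c : chain c -> sorted <=%O (sort <=%O (enum c)).
Proof.
move=> /forall_inP ch; apply: (@sort_sorted_in _ (mem c)); last first.
  by apply/allP => x; rewrite mem_enum.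
by move=> x y xc yc; have /forall_inP/(_ y yc) := ch x xc.
Qed.

Lemma path_chain x s : path covers x s -> chain [set w in x :: s].
Proof.
move=> /covers_path_le xs; apply/forall_inP => u; rewrite inE => us.
apply/forall_inP => v; rewrite inE => vs.
have xs' : sorted <=%O (x :: s) by [].
case/(nthP x): us => i lti <-; case/(nthP x): vs => j ltj <-.
have mono := sorted_leq_nth le_trans lexx x xs'.
case: (leqP i j) => [lij|/ltnW lji]; first by rewrite /Order.comparable mono.
by rewrite comparable_sym /Order.comparable mono.
Qed.

Lemma sort_path x s : path covers x s -> sort <=%O (enum [set w in x :: s]) = x :: s.
Proof.
move=> xs; apply: (sorted_eq le_trans le_anti).
- exact/chain_sorted/path_chain.
- exact: covers_path_le.
rewrite perm_sort; apply: uniq_perm; rewrite ?enum_uniq //.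
  by apply: (sorted_uniq lt_trans ltxx); exact: covers_path_lt.
by move=> w; rewrite mem_enum inE.
Qed.

Lemma path_maxchain x s : path covers x s -> maxchain x (last x s) [set w in x :: s].
Proof.
move=> xs; apply/maxsetP; split.
  rewrite path_chain //=; apply/subsetP => w; rewrite !inE.
  have /= := covers_path_le xs; rewrite (path_sortedE le_trans) => /andP[/allP xall _].
  move=> ws; apply/andP; split.
    by case/predU1P: ws => [->|/xall].
  elim: s x xs w ws {xall} => [|z s IHs] x /= => [_ w|]; first by rewrite orbF => /eqP ->.
  move=> /andP[/covers_lt/ltW xz zs] w /predU1P[->|ws]; last exact: IHs.
  exact: le_trans xz (covers_path_last zs).
move=> c' /andP[/forall_inP ch /subsetP sub] le_c; apply/eqP; rewrite eqEsubset le_c andbT.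
apply/subsetP => w wc; rewrite inE; apply: covers_path_mem => //.
  by have := sub w wc; rewrite inE.
move=> z zs; have zc : z \in c' by apply: (subsetP le_c); rewrite inE.
by have /forall_inP/(_ w wc) := ch z zc.
Qed.

Lemma maxchain_path x y c : (x <= y)%O -> maxchain x y c ->
  exists s, [/\ path covers x s, last x s = y & c = [set w in x :: s]].
Proof.
move=> xy /maxsetP[/andP[ch sub] maxc].
have in_c w : (x <= w <= y)%O -> {in c, forall u, (u >=< w)%O} -> w \in c.
  move=> xwy cw; rewrite -(maxc (w |: c)) ?setU11 ?subsetUr //; apply/andP; split; last first.
    by rewrite subUset sub andbT sub1set inE.
  apply/forall_inP => u; rewrite !inE => /predU1P[->|uc]; apply/forall_inP => v;
    rewrite !inE => /predU1P[->|vc].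
  - by rewrite comparablexx.
  - by rewrite comparable_sym cw.
  - exact: cw.
  - by move/forall_inP: ch => /(_ u uc)/forall_inP/(_ v vc).
have bnd u : u \in c -> (x <= u <= y)%O by move/(subsetP sub); rewrite inE.
have xc : x \in c.
  by apply: in_c => [|u /bnd/andP[xu _]]; rewrite ?lexx // comparable_sym /Order.comparable xu.
have yc : y \in c.
  by apply: in_c => [|u /bnd/andP[_ uy]]; rewrite ?lexx ?andbT // /Order.comparable uy.
have := chain_sorted ch; have := mem_sort <=%O (enum c); have := sort_uniq <=%O (enum c).
rewrite enum_uniq; case: (sort _ _) => [|h s] Us mems; first by move: (mems x); rewrite mem_enum xc.
have memc u : (u \in h :: s) = (u \in c) by rewrite mems mem_enum.
move=> hs; have hs_lt : sorted <%O (h :: s) by rewrite lt_sorted_uniq_le Us.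
have mono := sorted_leq_nth le_trans lexx x hs.
have nthi i : i < (size s).+1 -> nth x (h :: s) i \in c by move=> lti; rewrite -memc mem_nth.
have eh : h = x.
  apply/le_anti; have /andP[-> _] := bnd h (etrans (esym (memc h)) (mem_head _ _)).
  rewrite andbT; move: (hs); rewrite /= (path_sortedE le_trans) => /andP[/allP hle _].
  by have := memc x; rewrite xc inE => /predU1P[->|/hle].
subst h; exists s; split; last by apply/setP => u; rewrite inE memc.
  apply/(pathP x) => i lti; apply/andP; split.
    by have /pathP/(_ i lti) := hs_lt; apply.
  apply/existsPn => z; apply/negP => /andP[lz zr].
  have cz u : u \in c -> (u <= nth x (x :: s) i)%O || (nth x s i <= u)%O.
    rewrite -memc => /(nthP x)[j ltj <-]; case: (leqP j i) => [le_ji|lt_ij].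
      by rewrite mono //= inE ltnW.
    by rewrite -[nth x s i]/(nth x (x :: s) i.+1) (mono i.+1 j) ?orbT.
  have zc : z \in c.
    apply: in_c => [|u /cz /orP[ul|ru]].
    - have /andP[xl _] := bnd _ (nthi i (ltnW lti)); rewrite (le_trans xl (ltW lz)) /=.
      by have /andP[_] := bnd _ (nthi i.+1 lti); apply: le_trans; exact: ltW.
    - by rewrite /Order.comparable (le_trans ul (ltW lz)).
    - by rewrite comparable_sym /Order.comparable (le_trans (ltW zr) ru).
  by case/orP: (cz z zc) => /le_lt_trans; [move/(_ _ lz)|move/(_ _ zr)]; rewrite ltxx.
apply/le_anti; have /andP[_ ->] /= := bnd (last x s) (etrans (esym (memc _)) (mem_last _ _)).
move: (memc y); rewrite yc => /(nthP x)[j ltj <-].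
by rewrite (last_nth x) mono ?inE.
Qed.

Lemma label_seq_path d' (L : porderType d') (lam : P -> P -> L) x s :
  path covers x s -> label_seq lam [set w in x :: s] = pairmap lam x s.
Proof. by move=> xs; rewrite /label_seq sort_path. Qed.

End ChainTheory.

Notation max_chains P := {m : {set P} | maxchain \bot%O \top%O m}.

Section MaximalChainDescentOrder.
Context {d : Order.disp_t} {P : finTBPOrderType d}.
Context {d' : Order.disp_t} {L : porderType d'}.

(* As [lam] is an EL-labeling, [m :&: itv x z] being ascending makes it the
   unique ascending maximal chain of [itv x z]. *)
Definition polygon_move (lam : EL_labeling P L) : rel (max_chains P) :=
  fun m m' => [exists x, exists y, exists z,
    [&& (x < z)%O,
        x \in val m :&: val m', z \in val m :&: val m',
        chain_below (val m) x == chain_below (val m') x,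
        chain_above (val m) z == chain_above (val m') z,
        val m' :&: itv x z == [set x; y; z], descent lam x y z, y \notin val m,
        maxchain x z (val m :&: itv x z) & ascending lam (val m :&: itv x z)]].

Definition mcd_order (lam : EL_labeling P L) (m m' : max_chains P) : Prop :=
  connect (polygon_move lam) m m'.

End MaximalChainDescentOrder.

(* A Young diagram is given by its row lengths; rows and columns are numbered
   from 0, and the box in row [i] and column [j] belongs to it when
   [j < nth 0 a i]. *)
Record young := Young {
  parts :> seq nat;
  partsP : sorted geq parts && (0 \notin parts) }.
HB.instance Definition _ := [isSub for parts].
HB.instance Definition _ := [Countable of young by <:].

Definition young_le (b a : young) : bool :=
  [forall i : 'I_(size b), nth 0 b i <= nth 0 a i].

Lemma young_leP (b a : young) :
  reflect (forall i, nth 0 b i <= nth 0 a i) (young_le b a).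
Proof.
apply: (iffP forallP) => [le_ba i | le_ba i]; last exact: le_ba.
case: (ltnP i (size b)) => [lti | gei]; first exact: (le_ba (Ordinal lti)).
by rewrite nth_default.
Qed.

Lemma nth_young (a : young) i j : i <= j -> nth 0 a j <= nth 0 a i.
Proof.
case: a => a /= /andP[sa _] leij; have [gej|ltj] := leqP (size a) j; first by rewrite nth_default.
by apply: (sorted_leq_nth (rev_trans leq_trans) leqnn 0 sa); rewrite ?inE // (leq_ltn_trans leij).
Qed.

Lemma nth_young_gt0 (a : young) i : (0 < nth 0 a i) = (i < size a).
Proof.
case: (ltnP i (size a)) => [lti | gei]; last by rewrite nth_default.
case: a lti => a /= /andP[_ a0] lti; rewrite lt0n; apply: contraNneq a0 => <-; exact: mem_nth.
Qed.

Lemma young_inj (a b : young) : (forall i, nth 0 a i = nth 0 b i) -> a = b.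
Proof.
move=> eqn; apply/val_inj/(@eq_from_nth _ 0) => [|i _]; last exact: eqn.
have le_size (y z : young) : (forall i, nth 0 y i = nth 0 z i) -> size y <= size z.
  by move=> eyz; rewrite leqNgt -nth_young_gt0 eyz nth_young_gt0 ltnn.
by apply/eqP; rewrite eqn_leq !le_size.
Qed.

Lemma young_le_refl : reflexive young_le.
Proof. by move=> a; apply/young_leP. Qed.

Lemma young_le_anti : antisymmetric young_le.
Proof.
move=> a b /andP[/young_leP ab /young_leP ba].
by apply: young_inj => i; apply/eqP; rewrite eqn_leq ab ba.
Qed.

Lemma young_le_trans : transitive young_le.
Proof.
by move=> b a c /young_leP ab /young_leP bc; apply/young_leP => i; exact: leq_trans (ab i) (bc i).
Qed.

Fact young_display : Order.disp_t. Proof. exact: Order.Disp tt tt. Qed.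

HB.instance Definition _ := Order.Le_isPOrder.Build young_display young
  young_le_refl young_le_anti young_le_trans.

Lemma empty_partsP : sorted geq [::] && (0 \notin [::]). Proof. by []. Qed.
Definition empty_diagram : young := Young empty_partsP.

Record young_itv (a : young) := YoungItv {
  diagram :> young;
  diagramP : (empty_diagram <= diagram <= a)%O }.
HB.instance Definition _ a := [isSub for @diagram a].
HB.instance Definition _ a := [Countable of young_itv a by <:].
HB.instance Definition _ a := [SubChoice_isSubPOrder of young_itv a by <: with young_display].

Definition box (a : young) : finType := {i : 'I_(size a) & 'I_(nth 0 a i)}.

Section YoungInterval.
Variable a : young.
Implicit Types (b : box a) (y : young_itv a).

Definition row b : nat := tag b.
Definition col b : nat := tagged b.

Definition in_diagram b (y : young) : bool := col b < nth 0 y (row b).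

Definition cells (y : young) : {set box a} := [set b | in_diagram b y].

Lemma col_lt b : col b < nth 0 a (row b). Proof. exact: ltn_ord. Qed.

Lemma box_exists i j : j < nth 0 a i -> exists b : box a, row b = i /\ col b = j.
Proof.
move=> ltj; have lti : i < size a by rewrite -nth_young_gt0 (leq_trans _ ltj).
by exists (Tagged (fun i : 'I_(size a) => 'I_(nth 0 a i)) (Ordinal ltj : 'I_(nth 0 a (Ordinal lti)))).
Qed.

Lemma box_inj b c : row b = row c -> col b = col c -> b = c.
Proof.
case: b c => [i j] [i' j']; rewrite /row /col /= => /val_inj eqi; case: _ / eqi j' => j' /val_inj -> //.
Qed.

Lemma le_diagram y : (diagram y <= a)%O. Proof. by case/andP: (diagramP y). Qed.

Lemma le_cells y1 y2 : (y1 <= y2)%O = (cells y1 \subset cells y2).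
Proof.
apply/young_leP/subsetP => [le12 b | sub12 i].
  by rewrite !inE => /leq_trans; apply.
rewrite leqNgt; apply/negP => lt21.
have [|b [rb cb]] := @box_exists i (nth 0 y2 i).
  by apply: leq_trans lt21 _; have /young_leP := le_diagram y1; apply.
by have := sub12 b; rewrite !inE /in_diagram rb cb lt21 ltnn => /(_ isT).
Qed.

Lemma cells_inj : injective (fun y => cells (diagram y)).
Proof. by move=> y1 y2 eq12; apply/le_anti; rewrite !le_cells eq12 subxx. Qed.

Definition box_le b c : bool := (row b <= row c) && (col b <= col c).

Definition ideal (D : {set box a}) : bool :=
  [forall b in D, forall c, box_le c b ==> (c \in D)].

Lemma cells_ideal y : ideal (cells y).
Proof.
apply/forall_inP => b; rewrite inE => bD; apply/forallP => c; apply/implyP => /andP[rcb ccb].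
by rewrite inE; apply: leq_ltn_trans ccb (leq_trans bD _); apply: nth_young.
Qed.

End YoungInterval.

Section YoungIntervalFinite.
Variable a : young.
Implicit Type y : young_itv a.

Lemma size_diagram y : size y <= size a.
Proof.
rewrite leqNgt -nth_young_gt0; apply/negP => lt.
by have := leq_trans lt (young_leP _ _ (le_diagram y) (size a)); rewrite nth_young_gt0 ltnn.
Qed.

Let encode y : {ffun 'I_(size a) -> 'I_(nth 0 a 0).+1} := [ffun i : 'I__ => inord (nth 0 y i)].

Let decode (f : {ffun 'I_(size a) -> 'I_(nth 0 a 0).+1}) : option (young_itv a) :=
  obind insub (insub [seq x <- [seq val (f i) | i <- enum 'I_(size a)] | x != 0]).

Lemma young_codeK : pcancel encode decode.
Proof.
move=> y; rewrite /decode.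
suff -> : [seq x <- [seq val (encode y i) | i <- enum 'I_(size a)] | x != 0] = y.
  by rewrite valK /= valK.
have -> : [seq val (encode y i) | i <- enum 'I_(size a)] = y ++ nseq (size a - size y) 0.
  have ->: [seq val (encode y i) | i <- enum 'I_(size a)] = [seq nth 0 y i | i <- iota 0 (size a)].
    rewrite -val_enum_ord -map_comp; apply: eq_map => i /=; rewrite ffunE inordK // ltnS.
    by apply: leq_trans (young_leP _ _ (le_diagram y) i) _; exact: nth_young.
  apply: (@eq_from_nth _ 0) => [|i]; rewrite ?size_map size_iota ?size_cat ?size_nseq ?subnKC ?size_diagram //.
  move=> lti; rewrite (nth_map 0) ?size_iota // nth_iota // add0n nth_cat nth_nseq if_same.
  by case: ltnP => // /(nth_default 0).
rewrite filter_cat (_ : [seq x <- nseq _ 0 | x != 0] = [::]) ?cats0; last first.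
  by elim: (_ - _).
apply/all_filterP/allP => x xy; case/andP: (partsP y) => _; by apply: contraNneq => <-.
Qed.

HB.instance Definition _ := isFinite.Build (young_itv a) (pcan_enumP young_codeK).

Lemma young_bot_subproof : (empty_diagram <= empty_diagram <= a)%O.
Proof. by rewrite lexx; apply/young_leP => i; rewrite nth_nil. Qed.

Lemma young_top_subproof : (empty_diagram <= a <= a)%O.
Proof. by rewrite lexx andbT; apply/young_leP => i; rewrite nth_nil. Qed.

Lemma young_le0 y : (YoungItv young_bot_subproof <= y)%O.
Proof. by apply/young_leP => i; rewrite nth_nil. Qed.

Lemma young_le1 y : (y <= YoungItv young_top_subproof)%O.
Proof. exact: le_diagram. Qed.

HB.instance Definition _ := Order.hasBottom.Build young_display (young_itv a) young_le0.
HB.instance Definition _ := Order.hasTop.Build young_display (young_itv a) young_le1.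

Lemma cells_add y (b : box a) : b \notin cells a y -> ideal (b |: cells a y) ->
  exists2 y' : young_itv a, cells a y' = b |: cells a y & (y < y')%O.
Proof.
move=> by_ /forall_inP idb.
have below c : box_le c b -> c != b -> in_diagram c y.
  move=> cb neqc; have := idb b (setU11 _ _) => /forallP/(_ c).
  by rewrite cb /= !inE (negPf neqc).
have colb : col b = nth 0 y (row b).
  apply/eqP; rewrite eqn_leq; move: (by_); rewrite inE -leqNgt /in_diagram => ->; rewrite andbT.
  case E: (col b) => [|j] //; have [|c [rc cc]] := @box_exists a (row b) j.
    by apply: ltn_trans (col_lt b); rewrite E.
  have := below c; rewrite /box_le /in_diagram rc cc leqnn E leqnSn => /(_ isT).
  by apply; apply/eqP => ecb; move: cc; rewrite ecb E => /eqP; rewrite eqn_leq ltnn.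
have rowb i : i < row b -> nth 0 y (row b) < nth 0 y i.
  move=> lti; have [|c [rc cc]] := @box_exists a i (col b).
    by apply: leq_trans (col_lt b) _; apply/nth_young/ltnW.
  have := below c; rewrite /box_le /in_diagram rc cc leqnn (ltnW lti) colb => /(_ isT).
  by apply; apply/eqP => ecb; move: lti; rewrite -rc ecb ltnn.
have le_size : row b <= size y.
  rewrite leqNgt; apply/negP => lt; have := rowb _ lt.
  by rewrite [X in _ < X]nth_default.
pose s := incr_nth y (row b).
have nths i : nth 0 s i = (row b == i) + nth 0 y i by rewrite nth_incr_nth.
have sP : sorted geq s && (0 \notin s).
  apply/andP; split.
    apply: (path_sorted (x := (nth 0 s 0))); apply/(pathP 0) => i lti.
    case: i lti => [|i] lti /=; first exact: leqnn.
    rewrite !nths; have lei : nth 0 y i.+1 <= nth 0 y i by exact: nth_young.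
    case: (row b =P i.+1) => [eqi|]; case: (row b =P i) => [eqi'|] //= *.
    - by rewrite add1n add0n -eqi; apply: rowb; rewrite eqi.
    - by rewrite add0n (leq_trans lei) ?leq_addl.
  apply/negP => /(nthP 0)[i lti]; rewrite nths => /eqP; rewrite addn_eq0 eqb0 => /andP[nbi].
  rewrite -leqn0 leqNgt nth_young_gt0 -leqNgt => lei.
  move: lti; rewrite /s size_incr_nth; case: (ltnP (row b) (size y)) => ltb lti.
    by rewrite ltnNge lei in lti.
  have eqb : row b = size y by apply/eqP; rewrite eqn_leq le_size.
  by move: nbi; rewrite eqb eqn_leq lei -ltnS -eqb lti.
have leA : (empty_diagram <= Young sP <= a)%O.
  apply/andP; split; apply/young_leP => i; first by rewrite nth_nil.
  rewrite /= nths; case: eqP => [<-|_]; first by rewrite add1n -colb; exact: col_lt.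
  by apply: young_leP; exact: le_diagram.
pose y' := YoungItv leA.
have cells' : cells a y' = b |: cells a y.
  apply/setP => c; rewrite !inE /in_diagram /= nths; case: (row b =P row c) => [eqr|neqr] /=.
    rewrite add1n ltnS leq_eqVlt -eqr -colb; congr (_ || _).
    by apply/eqP/eqP => [eqc | -> //]; apply: box_inj.
  by case: eqP => // eqc; case: neqr; rewrite eqc.
exists y' => //; rewrite lt_neqAle le_cells cells' subsetUr andbT.
by apply: contraNneq by_ => ->; rewrite cells' setU11.
Qed.

End YoungIntervalFinite.

(* Entries and positions are numbered from 0: the element [k] of ['I_n] stands
   for the integer [k + 1] of {1, ..., n}. *)
Definition standard (a : young) (T : {ffun box a -> 'I_(sumn a)}) : bool :=
  [&& injectiveb T, [forall k, k \in codom T],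
      [forall b, forall c, (row b == row c) && (col b < col c) ==> (T b < T c)]
    & [forall b, forall c, (col b == col c) && (row b < row c) ==> (T b < T c)]].

Record std_tableau (a : young) := StdTableau {
  entry :> {ffun box a -> 'I_(sumn a)};
  entryP : standard entry }.
HB.instance Definition _ a := [isSub for @entry a].
HB.instance Definition _ a := [Finite of std_tableau a by <:].

(* When [y] covers [x] exactly one box is in [y] and not in [x]. The successor
   turns an element of ['I_n] into an entry in {1, ..., n}. *)
Definition tableau_label (a : young) (T : std_tableau a) (x y : young_itv a) : nat :=
  if [pick b : box a | in_diagram b y && ~~ in_diagram b x] is Some b
  then (T b).+1 else 0.

Section TableauLabeling.
Variables (a : young) (T : std_tableau a).
Implicit Types (b c : box a) (x y z : young_itv a) (s : seq (young_itv a)).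

Lemma entry_inj : injective T.
Proof. by case/and4P: (entryP T) => /injectiveP. Qed.

Lemma entry_row b c : row b = row c -> col b < col c -> T b < T c.
Proof.
case/and4P: (entryP T) => _ _ /forallP/(_ b)/forallP/(_ c) + _.
by move=> /implyP imp eqbc ltbc; apply: imp; rewrite eqbc eqxx.
Qed.

Lemma entry_col b c : col b = col c -> row b < row c -> T b < T c.
Proof.
case/and4P: (entryP T) => _ _ _ /forallP/(_ b)/forallP/(_ c).
by move=> /implyP imp eqbc ltbc; apply: imp; rewrite eqbc eqxx.
Qed.

Lemma entry_mono b c : box_le b c -> T b <= T c.
Proof.
case/andP=> rbc cbc.
have [|e [re ce]] := @box_exists a (row b) (col c).
  exact: leq_trans (col_lt c) (nth_young a rbc).
apply: (@leq_trans (T e)).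
  move: cbc; rewrite -ce leq_eqVlt => /predU1P[eqc | ltc]; last exact/ltnW/entry_row.
  by rewrite (_ : b = e) //; apply: box_inj.
move: rbc; rewrite -re leq_eqVlt => /predU1P[eqr | ltr]; last exact/ltnW/entry_col.
by rewrite (_ : e = c) //; apply: box_inj.
Qed.

Lemma add_min_box x y : (x < y)%O -> exists b x',
  [/\ b \in cells a y :\: cells a x, cells a x' = b |: cells a x, (x < x' <= y)%O
    & forall c, c \in cells a y :\: cells a x -> T b <= T c].
Proof.
rewrite lt_neqAle le_cells => /andP[neq sub].
have [b0 b0D] : exists b, b \in cells a y :\: cells a x.
  apply/set0Pn; apply: contraNneq neq => /eqP; rewrite setD_eq0 => sub'.
  by apply/eqP/(@cells_inj a)/eqP; rewrite eqEsubset sub sub'.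
case: (arg_minnP (fun b => T b : nat) b0D) => b bD minb.
have [bx by_] : b \notin cells a x /\ b \in cells a y by apply/andP; rewrite -in_setD.
case: (@cells_add a x b bx) => [|x' cx' ltx].
  apply/forall_inP => c; rewrite in_setU1 => cb; apply/forallP => e; apply/implyP => le_ec.
  rewrite in_setU1; case/predU1P: cb => [eqc | cx]; last first.
    by have /forall_inP/(_ c cx)/forallP/(_ e) := cells_ideal x; rewrite le_ec /= => ->; rewrite orbT.
  case: (boolP (e \in cells a x)) => ex; first by rewrite orbT.
  rewrite orbF; apply/eqP/entry_inj/val_inj/anti_leq; rewrite -{1}eqc entry_mono //=.
  apply: minb; apply/setDP; split=> //.
  by have /forall_inP/(_ b by_)/forallP/(_ e) := cells_ideal y; rewrite -eqc le_ec.
exists b, x'; split=> //.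
by rewrite ltx le_cells cx' subUset sub1set by_ sub.
Qed.

Lemma covers_add x y : covers x y ->
  exists2 b, b \notin cells a x & cells a y = b |: cells a x.
Proof.
case/andP=> ltxy /existsPn nz; have [b [x' [bD cx' /andP[ltx lex'] _]]] := add_min_box ltxy.
exists b; first by case/setDP: bD.
rewrite -cx'; congr (cells a _); have := nz x'; rewrite ltx /= lt_neqAle lex' andbT negbK.
by move/eqP => ->.
Qed.

Lemma add_covers x y b : b \notin cells a x -> cells a y = b |: cells a x -> covers x y.
Proof.
move=> bx cy; have neq u v : cells a (diagram u) != cells a (diagram v) -> u != v.
  by apply: contraNneq => ->.
apply/andP; split.
  rewrite lt_neqAle le_cells cy subsetUr andbT; apply: neq.
  by apply: contraNneq bx => ->; rewrite cy setU11.
apply/existsPn => z; rewrite !lt_neqAle !le_cells.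
apply/negP => /andP[/andP[nxz sxz] /andP[nzy szy]].
case: (boolP (b \in cells a z)) => bz.
  case/eqP: nzy; apply/le_anti; rewrite !le_cells szy cy subUset sub1set bz.
  by [].
case/eqP: nxz; apply/le_anti; rewrite !le_cells sxz /=.
apply/subsetP => c cz; have := subsetP szy c cz; rewrite cy in_setU1 => /predU1P[eqc|//].
by rewrite -eqc cz in bz.
Qed.

Lemma label_add x y b : b \notin cells a x -> cells a y = b |: cells a x ->
  tableau_label T x y = (T b).+1.
Proof.
move=> bx cy; rewrite /tableau_label; case: pickP => [c | /(_ b)].
  have -> : in_diagram c y && ~~ in_diagram c x = (c \in cells a y :\: cells a x).
    by rewrite !inE andbC.
  by rewrite cy !inE; case: eqP => [->//|_]; rewrite andNb.
have -> : in_diagram b y && ~~ in_diagram b x = (b \in cells a y :\: cells a x).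
  by rewrite !inE andbC.
by rewrite inE bx cy setU11.
Qed.

Let labels x s : seq nat := pairmap (tableau_label T) x s.

Lemma labels_perm x s : path covers x s ->
  perm_eq (labels x s) [seq (T b).+1 | b <- enum (cells a (last x s) :\: cells a x)].
Proof.
elim: s x => [|z s IHs] x /=; first by rewrite setDv enum_set0.
move=> /andP[xz zs]; have [b bx cz] := covers_add xz; rewrite (label_add bx cz).
have sub : cells a z \subset cells a (last z s) by rewrite -le_cells covers_path_last.
have bl : b \in cells a (last z s) by apply: (subsetP sub); rewrite cz setU11.
apply: (@perm_trans _ ((T b).+1 :: [seq (T b).+1 | b <- enum (cells a (last z s) :\: cells a z)])).
  by rewrite perm_cons; exact: IHs.
rewrite -(map_cons (fun b => (T b).+1)); apply: perm_map.
apply: uniq_perm; rewrite /= ?enum_uniq ?andbT ?mem_enum ?cz ?inE ?eqxx //.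
move=> c; rewrite in_cons !mem_enum !in_setD in_setU1 negb_or.
by case: eqP => //= ->; rewrite bx bl.
Qed.

Lemma labels_inj x s s' : path covers x s -> path covers x s' ->
  labels x s = labels x s' -> s = s'.
Proof.
elim: s s' x => [|z s IHs] [|z' s'] x //= /andP[xz zs] /andP[xz' zs'] [].
have [b bx cz] := covers_add xz; have [b' bx' cz'] := covers_add xz'.
rewrite (label_add bx cz) (label_add bx' cz') => -[/val_inj/entry_inj eqb].
have eqz : z = z' by apply: cells_inj; rewrite /= cz cz' eqb.
by move: zs'; rewrite -eqz => zs' /(IHs _ _ zs zs') ->.
Qed.

Lemma ascending_path x y : (x <= y)%O ->
  exists s, [/\ path covers x s, last x s = y & sorted <=%O (labels x s)].
Proof.
have [k] := ubnP #|cells a y :\: cells a x|; elim: k x => // k IHk x lek.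
rewrite le_eqVlt => /predU1P[<-|ltxy]; first by exists [::].
have [b [z [bD cz /andP[ltxz lezy] minb]]] := add_min_box ltxy.
have bx : b \notin cells a x by case/setDP: bD.
have subD : cells a y :\: cells a z \subset cells a y :\: cells a x.
  by rewrite setDS // -le_cells ltW.
case: (IHk z) => [||s [zs lzs srt]] //.
  rewrite -ltnS; apply: leq_trans lek; rewrite ltnS; apply: proper_card; rewrite properE subD.
  by apply/subsetPn; exists b; rewrite // cz !inE eqxx.
exists (z :: s); rewrite /= zs (add_covers bx cz) lzs; split=> //.
rewrite (path_sortedE le_trans) srt andbT (label_add bx cz); apply/allP => l.
rewrite -/(labels z s) (perm_mem (labels_perm zs)) lzs => /mapP[c].
rewrite mem_enum => cD ->; rewrite leEnat ltnS; apply: minb; exact: (subsetP subD).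
Qed.

Lemma sorted_lexi_le (u v : seq nat) :
  sorted <=%O u -> perm_eq u v -> ((u : seqlexi nat) <= v)%O.
Proof.
elim: u v => [|i u IHu] [|j v] // srt; first by move/perm_size.
move=> puv; rewrite lexi_cons.
have le_ij : (i <= j)%O.
  have : j \in i :: u by rewrite (perm_mem puv) mem_head.
  move: srt; rewrite /= (path_sortedE le_trans) => /andP[/allP ile _].
  by rewrite inE => /predU1P[->|/ile].
rewrite le_ij /=; apply/implyP => le_ji.
have eqij : i = j by apply/le_anti; rewrite le_ij le_ji.
by subst j; apply: IHu; [exact: path_sorted srt | move: puv; rewrite perm_cons].
Qed.

Lemma tableau_label_EL : is_EL (tableau_label T).
Proof.
move=> x y /ltW xy; have [s [xs lxs srt]] := ascending_path xy.
have chains (m : {set young_itv a}) : maxchain x y m -> exists s', [/\ path covers x s', m = [set w in x :: s'],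
    label_seq (tableau_label T) m = labels x s' & perm_eq (labels x s) (labels x s')].
  move=> /(maxchain_path xy)[s' [xs' lxs' ->]]; exists s'; split=> //.
    exact: label_seq_path.
  by rewrite (perm_trans (labels_perm xs)) // perm_sym (perm_trans (labels_perm xs')) // lxs lxs'.
exists [set w in x :: s]; rewrite /ascending label_seq_path //; split=> // [|m mc|m mc neqm].
- by rewrite -lxs; exact: path_maxchain.
- have [s' [xs' -> _ pss']] := chains m mc; rewrite label_seq_path // => srt'.
  suff -> : s = s' by []; apply: labels_inj xs xs' _.
  exact: (sorted_eq le_trans le_anti).
have [s' [xs' eqm -> pss']] := chains m mc; rewrite lt_neqAle (sorted_lexi_le srt pss') andbT.
by apply: contraNneq neqm => /(labels_inj xs xs') ->; rewrite eqm.
Qed.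

Definition tableau_EL : EL_labeling (young_itv a) nat := ELLabeling tableau_label_EL.

End TableauLabeling.

Section RowTableau.
Variable a : young.
Implicit Types (b c : box a) (T : std_tableau a).

Lemma row_entry_lt b : sumn (take (row b) a) + col b < sumn a.
Proof. exact: flatten_indexP (col_lt b). Qed.

Definition row_filling : {ffun box a -> 'I_(sumn a)} := [ffun b => Ordinal (row_entry_lt b)].

Lemma card_box : #|box a| = sumn a.
Proof.
rewrite card_tagged; congr sumn; rewrite -[RHS](mkseq_nth 0) /mkseq -val_enum_ord -map_comp.
by apply: eq_map => i /=; rewrite card_ord.
Qed.

Lemma row_filling_inj : injective row_filling.
Proof.
move=> b c; rewrite !ffunE => -[eq_bc]; apply: box_inj.
  by rewrite -(flatten_indexKl (col_lt b)) -(flatten_indexKl (col_lt c)) /flatten_index eq_bc.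
by rewrite -(flatten_indexKr (col_lt b)) -(flatten_indexKr (col_lt c)) /flatten_index eq_bc.
Qed.

Lemma row_filling_row b c : row b < row c -> row_filling b < row_filling c.
Proof.
move=> lt_bc; rewrite !ffunE /=; apply: (@leq_trans (sumn (take (row b).+1 a))).
  by rewrite (take_nth 0) ?sumn_rcons ?ltn_add2l ?col_lt // -nth_young_gt0 (leq_trans _ (col_lt b)).
rewrite (leq_trans _ (leq_addr _ _)) // -(cat_take_drop (row b).+1 (take (row c) a)) sumn_cat.
by rewrite take_takel // leq_addr.
Qed.

Lemma row_filling_col b c : row b = row c -> col b < col c -> row_filling b < row_filling c.
Proof. by move=> eqr ltc; rewrite !ffunE /= eqr ltn_add2l. Qed.

Lemma standardI (T : {ffun box a -> 'I_(sumn a)}) : injective T ->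
  (forall b c, row b = row c -> col b < col c -> T b < T c) ->
  (forall b c, col b = col c -> row b < row c -> T b < T c) -> standard T.
Proof.
move=> injT rowT colT; apply/and4P; split; first exact/injectiveP.
- by apply/forallP => k; apply: inj_card_onto; rewrite // card_ord card_box.
- by apply/forallP => b; apply/forallP => c; apply/implyP => /andP[/eqP]; exact: rowT.
- by apply/forallP => b; apply/forallP => c; apply/implyP => /andP[/eqP]; exact: colT.
Qed.

Lemma row_filling_standard : standard row_filling.
Proof.
by apply: standardI => *; [exact: row_filling_inj | exact: row_filling_col | exact: row_filling_row].
Qed.

Definition row_tableau : std_tableau a := StdTableau row_filling_standard.

Definition row_reading_seq : seq (box a) :=
  flatten [seq [seq Tagged (fun i : 'I_(size a) => 'I_(nth 0 a i)) j
                   | j <- enum 'I_(nth 0 a i)]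
              | i : 'I_(size a) <- enum 'I_(size a)].

Lemma row_reading_size : size row_reading_seq == sumn a.
Proof.
rewrite size_allpairs_dep; apply/eqP; congr sumn.
rewrite -[RHS](mkseq_nth 0) /mkseq -val_enum_ord -map_comp.
by apply: eq_map => i /=; rewrite size_enum_ord.
Qed.

Definition row_reading : (sumn a).-tuple (box a) := Tuple row_reading_size.

Lemma row_reading_uniq : uniq row_reading.
Proof.
apply: allpairs_uniq_dep => [|i _|]; rewrite ?enum_uniq //.
by move=> [i j] [i' j'] _ _ /= /eqP; rewrite -tag_eqE /tag_eq /= => /andP[/eqP eqi];
   case: _ / eqi j' => j'; rewrite tagged_asE => /eqP ->.
Qed.

Lemma row_word_subproof T : injective (fun p => T (tnth row_reading p)).
Proof.
move=> p q /entry_inj; have x0 := tnth row_reading p.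
rewrite (tnth_nth x0 _ p) (tnth_nth x0 _ q) => /eqP.
by rewrite nth_uniq ?size_tuple ?row_reading_uniq // => /eqP/val_inj.
Qed.

Definition row_word T : 'S_(sumn a) := perm (@row_word_subproof T).

Definition left_step : rel (std_tableau a) := fun Q T =>
  [exists i : 'I_(sumn a), exists j : 'I_(sumn a),
    [&& j == i.+1 :> nat, entry T == [ffun b => tperm i j (Q b)]
      & [exists b, exists c, [&& Q b == i, Q c == j & row b < row c]]]].

Definition left_order (Q T : std_tableau a) : Prop := connect left_step Q T.

End RowTableau.

Section SymmetricGroup.
Variable n : nat.
Implicit Types u v w : 'S_n.

(* The product of 'S_n used here is composition of functions from right to
   left, whereas [(v * w)%g] maps [x] to [w (v x)]. *)
Definition pcomp w v : 'S_n := (v * w)%g.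

Definition simple_refl : {set 'S_n} :=
  [set s | [exists i : 'I_n, exists j : 'I_n, (j == i.+1 :> nat) && (s == tperm i j)]].

Definition inv_set w : {set 'I_n * 'I_n} :=
  [set p : 'I_n * 'I_n | (p.1 < p.2) && (w p.2 < w p.1)].

Lemma inv_set1 : inv_set 1 = set0.
Proof. by apply/setP => p; rewrite !inE !perm1; case: ltngtP. Qed.

Lemma inv_set_tperm w (i j : 'I_n) : j = i.+1 :> nat -> (w^-1)%g i < (w^-1)%g j ->
  #|inv_set (w * tperm i j)%g| = #|inv_set w|.+1.
Proof.
move=> eqj lt_ij; pose p0 := ((w^-1)%g i, (w^-1)%g j).
have -> : inv_set (w * tperm i j)%g = p0 |: inv_set w.
  apply/setP => [[x y]]; rewrite !inE /= !permM xpair_eqE.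
  rewrite -(inj_eq (@perm_inj _ w) x) -(inj_eq (@perm_inj _ w) y) !permKV.
  have [ltxy|leyx] /= := ltnP x y; last first.
    rewrite orbF; apply/esym/negbTE/negP => /andP[/eqP ex /eqP ey].
    by move: lt_ij; rewrite -ex -ey !permK; lia.
  have ne : w x != w y :> nat by rewrite (inj_eq val_inj) (inj_eq perm_inj); apply: contraTneq ltxy => ->; rewrite ltnn.
  have noc : ~~ ((w x == j) && (w y == i)).
    apply/negP => /andP[/eqP ex /eqP ey]; move: lt_ij; rewrite -ex -ey !permK; lia.
  move: (w x) (w y) ne noc => {ltxy lt_ij p0} wx wy.
  by do 2 case: tpermP => [->|->|/eqP + /eqP +] //=; rewrite -?(inj_eq val_inj) /=; lia.
rewrite cardsU1 (_ : p0 \in inv_set w = false) //.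
by rewrite inE /= !permKV; lia.
Qed.

Lemma inv_set_tperm_desc w (i j : 'I_n) : j = i.+1 :> nat -> (w^-1)%g j < (w^-1)%g i ->
  #|inv_set w| = #|inv_set (w * tperm i j)%g|.+1.
Proof.
move=> eqj lt_ji; rewrite -(@inv_set_tperm _ i j) //.
  by rewrite -mulgA tperm2 mulg1.
by rewrite invMg tpermV !permM tpermL tpermR.
Qed.

Lemma inv_set_bound w k : w \in (simple_refl ^+ k)%g -> #|inv_set w| <= k.
Proof.
elim: k w => [|k IHk] w; first by rewrite expg0 => /set1gP ->; rewrite inv_set1 cards0.
rewrite expgSr => /mulsgP[u s /IHk le_uk]; rewrite inE.
move=> /existsP[i /existsP[j /andP[/eqP eqj /eqP ->]]] ->.
have [lt|gt|/val_inj/perm_inj eqij] := ltngtP ((u^-1)%g i) ((u^-1)%g j).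
- by rewrite inv_set_tperm.
- by rewrite (inv_set_tperm_desc eqj gt) in le_uk; apply: leqW; exact: ltnW.
- by move: eqj; rewrite eqij; lia.
Qed.

Lemma perm_ge_id u : (forall i j : 'I_n, j = i.+1 :> nat -> u i < u j) ->
  forall k : 'I_n, k <= u k.
Proof.
move=> incr [k ltk]; elim: k ltk => // k IHk ltk /=.
exact: leq_ltn_trans (IHk (ltnW ltk)) (incr (Ordinal (ltnW ltk)) (Ordinal ltk) _).
Qed.

Lemma perm_incr_id u : (forall i j : 'I_n, j = i.+1 :> nat -> u i < u j) -> u = 1%g.
Proof.
move=> incr; have mono (x y : 'I_n) : x < y -> u x < u y.
  case: x y => x ltx [y lty] /=; elim: y lty => // y IHy lty.
  rewrite ltnS leq_eqVlt => /predU1P[eqx|ltxy]; first by apply: incr; rewrite /= eqx.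
  exact: ltn_trans (IHy (ltnW lty) ltxy) (incr (Ordinal (ltnW lty)) (Ordinal lty) _).
have geV := @perm_ge_id u^-1%g; apply/permP => k; rewrite perm1; apply/val_inj/anti_leq.
rewrite perm_ge_id // andbT -{2}(permK u k); apply: geV => i j eqj.
rewrite ltnNge leq_eqVlt negb_or -leqNgt; apply/andP; split.
  by rewrite (inj_eq val_inj) (inj_eq perm_inj); apply/eqP => /(congr1 val) /=; lia.
by rewrite leqNgt; apply/negP => /mono; rewrite !permKV; lia.
Qed.

Lemma inv_set_simple w : w \in (simple_refl ^+ #|inv_set w|)%g.
Proof.
have [m] := ubnP #|inv_set w|; elim: m w => // m IHm w ltm.
case: (boolP [exists i : 'I_n, exists j : 'I_n, (j == i.+1 :> nat) && ((w^-1)%g j < (w^-1)%g i)]).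
  move=> /existsP[i /existsP[j /andP[/eqP eqj ltji]]].
  have eqw := inv_set_tperm_desc eqj ltji; rewrite eqw expgSr.
  have -> : w = (w * tperm i j * tperm i j)%g by rewrite -mulgA tperm2 mulg1.
  apply: mem_mulg; last by rewrite inE; apply/existsP; exists i; apply/existsP; exists j; rewrite eqj !eqxx.
  by rewrite -mulgA tperm2 mulg1; apply: IHm; rewrite -eqw.
move=> /existsPn noex; suff -> : w = 1%g by rewrite inv_set1 cards0 expg0 set11.
apply: invg_inj; rewrite invg1; apply: perm_incr_id => i j eqj.
have /existsPn/(_ j) := noex i; rewrite eqj eqxx /= -leqNgt leq_eqVlt => /predU1P[/val_inj/perm_inj eqij|//].
by move: eqj; rewrite eqij; lia.
Qed.

Lemma perm_length_subproof w : exists k, w \in (simple_refl ^+ k)%g.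
Proof. by exists #|inv_set w|; exact: inv_set_simple. Qed.

(* [simple_refl ^+ k] is the set of all products of [k] simple reflections. *)
Definition perm_length w : nat := ex_minn (perm_length_subproof w).

Lemma perm_lengthE w : perm_length w = #|inv_set w|.
Proof.
rewrite /perm_length; case: ex_minnP => k wk mink; apply/anti_leq.
by rewrite mink ?inv_set_simple ?inv_set_bound.
Qed.

Definition quotient_by (V : {set 'S_n}) : {set 'S_n} :=
  [set w | [forall v in V, perm_length (pcomp w v) == perm_length w + perm_length v]].

Record gen_quotient := GenQuotient {
  quotient_set :> {set 'S_n};
  gen_quotientP : exists V, quotient_set = quotient_by V }.

Definition left_mult_word u (s : seq 'S_n) : 'S_n := foldl (fun x r => pcomp r x) u s.

Definition left_weak u w : Prop :=
  exists s : seq 'S_n, [/\ {subset s <= simple_refl}, w = left_mult_word u s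
    & forall j, 1 <= j <= size s ->
        perm_length (left_mult_word u (take j s)) = perm_length u + j].

Definition weak_order (Q : gen_quotient) (u w : {x : 'S_n | x \in quotient_set Q}) : Prop :=
  left_weak (val u) (val w).

Let ordp (x y : 'I_n) := if x < y then (x, y) else (y, x).
Let act u (p : 'I_n * 'I_n) := ordp (u p.1) (u p.2).

Lemma card_inv_pcomp w v : #|inv_set (pcomp w v)| =
  #|inv_set w :\: inv_set v^-1%g| + #|inv_set v^-1%g :\: inv_set w|.
Proof.
have actK u (p : 'I_n * 'I_n) : p.1 < p.2 -> act u^-1%g (act u p) = p.
  case: p => x y /= ltxy; rewrite /act /ordp /=.
  by case: (u x < u y) => /=; rewrite !permK ?ltxy // ltnNge (ltnW ltxy).
have act_lt u (p : 'I_n * 'I_n) : p.1 < p.2 -> (act u p).1 < (act u p).2.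
  case: p => x y /= ltxy; rewrite /act /ordp /=; case: (ltngtP (u x) (u y)) => //= /val_inj/perm_inj eqxy.
  by rewrite eqxy ltnn in ltxy.
have inv_act (p : 'I_n * 'I_n) : p.1 < p.2 -> (p \in inv_set (pcomp w v)) =
    (act v p \in inv_set w) (+) (act v p \in inv_set v^-1%g).
  case: p => x y /= ltxy; rewrite !inE /= ltxy !permM /act /ordp /=.
  case: (ltngtP (v x) (v y)) => [lt|gt|/val_inj/perm_inj eqxy] /=; last by rewrite eqxy ltnn in ltxy.
  - by rewrite lt /= !permK [y < x]ltnNge (ltnW ltxy) addbF.
  - rewrite gt /= !permK ltxy addbT -leqNgt ltn_neqAle; case: eqP => // /val_inj/perm_inj/perm_inj eqyx.
    by rewrite eqyx ltnn in ltxy.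
have <- : #|act v @: inv_set (pcomp w v)| = #|inv_set (pcomp w v)|.
  rewrite card_in_imset // => p q; rewrite !inE => /andP[ltp _] /andP[ltq _].
  by move=> /(congr1 (act v^-1%g)); rewrite !actK.
rewrite -cardsUI [X in _ + X](_ : _ = 0) ?addn0; last first.
  by apply/eqP; rewrite cards_eq0; apply/eqP/setP => p; rewrite !in_setI !in_setD in_set0;
     do 2 case: (p \in _).
apply: eq_card => q; have -> : (q \in (inv_set w :\: inv_set v^-1) :|: (inv_set v^-1 :\: inv_set w))%g
    = (q \in inv_set w) (+) (q \in inv_set v^-1%g).
  by rewrite in_setU !in_setD; do 2 case: (q \in _).
apply/imsetP/idP => [[p pI ->]|].
  by rewrite -inv_act //; move: pI; rewrite inE => /andP[].
move=> qI; have ltq : q.1 < q.2 by move: qI; rewrite !inE; case: (q.1 < q.2).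
have eqq : act v (act v^-1%g q) = q by rewrite -{1}(invgK v) actK.
by exists (act v^-1%g q); rewrite // inv_act ?eqq ?act_lt.
Qed.

Lemma card_invV v : #|inv_set v| = #|inv_set v^-1%g|.
Proof.
by have := card_inv_pcomp 1 v; rewrite /pcomp mulg1 inv_set1 set0D setD0 cards0.
Qed.

Lemma length_pcompP w v : (perm_length (pcomp w v) == perm_length w + perm_length v) =
  (inv_set w :&: inv_set v^-1%g == set0).
Proof.
rewrite !perm_lengthE card_inv_pcomp (card_invV v).
rewrite -(cardsID (inv_set v^-1%g) (inv_set w)) -(cardsID (inv_set w) (inv_set v^-1%g)).
by rewrite -cards_eq0 [X in _ == _ + (#|pred_of_set X| + _)]setIC; lia.
Qed.

End SymmetricGroup.

Section RowWordQuotient.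
Variable a : young.
Implicit Types (b c e : box a) (T : std_tableau a).

Definition row_words : {set 'S_(sumn a)} := [set row_word T | T : std_tableau a].

Let R := row_filling a.
Let reading := tnth (row_reading a).

Lemma row_readingK p : R (reading p) = p.
Proof.
have readR b : reading (R b) = b.
  rewrite /reading (tnth_nth b) /= ffunE /= nth_flatten.
  set ss := map _ _; have -> : shape ss = a.
    rewrite /shape -map_comp -[RHS](mkseq_nth 0) /mkseq -val_enum_ord -map_comp.
    by apply: eq_map => i /=; rewrite size_map size_enum_ord.
  rewrite -/(flatten_index a (row b) (col b)) flatten_indexKl ?flatten_indexKr ?col_lt //.
  case: b => i j; rewrite /row /col /= {}/ss (nth_map i) ?size_enum_ord // nth_ord_enum.
  by rewrite (nth_map j) ?size_enum_ord // nth_ord_enum.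
have bijR : bijective R by apply: inj_card_bij; [exact: row_filling_inj | rewrite card_ord card_box].
by apply: (bij_inj (bij_can_bij bijR readR)); rewrite readR.
Qed.

Lemma reading_lt (p q : 'I_(sumn a)) : p < q ->
  (row (reading p) < row (reading q)) ||
  (row (reading p) == row (reading q)) && (col (reading p) < col (reading q)).
Proof.
move=> ltpq; case: (ltngtP (row (reading p)) (row (reading q))) => //= [gt | eqr].
  by have := row_filling_row gt; rewrite -/R !row_readingK; lia.
rewrite ltnNge leq_eqVlt; apply/negP => /predU1P[eqc | ltc].
  by move: ltpq; rewrite -(row_readingK p) -(row_readingK q) (box_inj eqr (esym eqc)) ltnn.
by have := row_filling_col (esym eqr) ltc; rewrite -/R !row_readingK; lia.
Qed.

(* [col_after b e]: [e] comes after [b] when reading down columns, leftmost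
   column first. *)
Let col_after b e := (col b < col e) || (col b == col e) && (row b < row e).

Let col_rank b := #|[set e | col_after b e]|.

Lemma col_rank_lt b : col_rank b < sumn a.
Proof.
rewrite -card_box -cardsT; apply: proper_card; rewrite properE subsetT /=.
by apply/subsetPn; exists b; rewrite !inE // /col_after !ltnn andbF.
Qed.

Lemma col_rank_mono b c : col_after b c -> col_rank c < col_rank b.
Proof.
move=> bc; apply: proper_card; rewrite properE; apply/andP; split.
  by apply/subsetP => e; rewrite !inE; move: bc; rewrite /col_after; lia.
by apply/subsetPn; exists c; rewrite !inE // /col_after !ltnn andbF.
Qed.

Lemma col_after_total b c : [|| b == c, col_after b c | col_after c b].
Proof.
case: (b =P c) => //= neq; rewrite /col_after.
case: (ltngtP (col b) (col c)) => //= eqc; case: (ltngtP (row b) (row c)) => //= eqr.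
by case: neq; apply: box_inj.
Qed.

Let rank_fun (p : 'I_(sumn a)) : 'I_(sumn a) := Ordinal (col_rank_lt (reading p)).

Lemma rank_fun_inj : injective rank_fun.
Proof.
move=> p q [eqpq]; rewrite -(row_readingK p) -(row_readingK q).
case/or3P: (col_after_total (reading p) (reading q)) => [/eqP-> // | |] /col_rank_mono;
  by rewrite eqpq ltnn.
Qed.

Let col_perm : 'S_(sumn a) := perm rank_fun_inj.

Lemma col_perm_inv (p q : 'I_(sumn a)) :
  ((p, q) \in inv_set col_perm) = (p < q) && box_le (reading p) (reading q).
Proof.
rewrite inE /= !permE /=; case: (ltnP p q) => //= ltpq.
have /= lex := reading_lt ltpq; apply/idP/idP => [lt_rank | le_box].
  case: (boolP (col_after (reading q) (reading p))) => [/col_rank_mono | ]; first by lia.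
  by rewrite /col_after /box_le; lia.
by apply: col_rank_mono; move: le_box lex; rewrite /col_after /box_le; lia.
Qed.

Lemma row_words_quotient : exists V, row_words = quotient_by V.
Proof.
exists [set col_perm^-1%g]; apply/setP => w; rewrite [RHS]inE.
have -> : [forall v in [set col_perm^-1%g],
    perm_length (pcomp w v) == perm_length w + perm_length v] =
    (inv_set w :&: inv_set col_perm == set0).
  apply/forall_inP/idP => [/(_ _ (set11 _)) | inv0 v /set1P ->]; by rewrite length_pcompP invgK.
apply/imsetP/eqP => [[T _ ->] | inv0].
  apply/setP => [[p q]]; rewrite in_setI col_perm_inv in_set0.
  apply/negP => /and3P[]; rewrite inE /= !permE => /andP[_ ltT] _ /entry_mono leT.
  by rewrite ltnNge leT in ltT.
have mono b c : R b < R c -> box_le b c -> w (R b) < w (R c).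
  move=> ltR lebc; rewrite ltn_neqAle; apply/andP; split.
    by apply: contraTneq ltR => /val_inj/perm_inj ->; rewrite ltnn.
  have : (R b, R c) \notin inv_set w :&: inv_set col_perm by rewrite inv0 in_set0.
  have RK : cancel R reading by move=> e; apply: row_filling_inj; exact: row_readingK.
  by rewrite in_setI col_perm_inv !RK lebc inE /= ltR !andbT -leqNgt.
have TE b : [ffun b => w (R b)] b = w (R b) by rewrite ffunE.
have stT : standard [ffun b => w (R b)].
  apply: standardI => [b c | b c eqr ltc | b c eqc ltr]; rewrite !TE.
  - by move=> /perm_inj; exact: row_filling_inj.
  - by apply: mono; rewrite ?row_filling_col // /box_le eqr leqnn ltnW.
  - by apply: mono; rewrite ?row_filling_row // /box_le eqc leqnn ltnW.
exists (StdTableau stT) => //; apply/permP => p.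
by rewrite permE /= TE row_readingK.
Qed.

Definition row_word_quotient : gen_quotient (sumn a) := GenQuotient row_words_quotient.

End RowWordQuotient.

(* Main.v *)
Require Import Defs.
From mathcomp Require Import all_boot all_order all_fingroup zify.

Set Implicit Arguments.
Unset Strict Implicit.
Unset Printing Implicit Defensive.

Import Order.TTheory.

(** A standard tableau [T] is a way of growing the diagram [a] one box at a time:
    its initial diagrams, formed by the boxes with entry less than [k] for
    [k = 0, ..., n], are the elements of a maximal chain [tableau_chain T], and
    every maximal chain arises so from exactly one tableau, which numbers the
    boxes by their time of arrival ([chain_of_tableau_bij]).

    Under this bijection the relations that generate the two orders agree. Let [Q]
    have the entries [i] and [i + 1] in the boxes [b] and [c]. Exchanging them
    changes the chain in the single diagram with [i + 1] boxes: around it, [Q] adds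
    [b] and then [c], while its swap [T] adds [c] and then [b]. A polygon move asks that the labels of [T] descend there,
    that is, that [c] has a larger entry than [b] in the row tableau; a left step
    asks that [c] is in a lower row than [b]. The row tableau numbers the boxes
    row after row, so the two conditions could differ only for [b] and [c] in one
    row; but then [b] would be left of [c], and [T] would not be standard
    ([row_descent], [left_step_polygon], [polygon_left_step]).

    For the weak order, read each tableau as a permutation. Swapping [i] and
    [i + 1] is the left multiplication by a simple reflection, and it increases
    the length exactly when [i] is read before [i + 1], which again means that it
    is in a higher row ([left_stepP]). A chain in the weak order could a priori
    leave the row words and come back; it does not, because a generalized quotient
    is closed downwards in the left weak order ([quotient_by_down]). *)

(** * Maximal chains and standard tableaux *)

Section TableauChains.
Variable a : young.
Implicit Types (b c e : box a) (x y z w : young_itv a) (Q T : std_tableau a).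
Implicit Types (m : {set young_itv a}) (k : nat).

Definition initial T k : {set box a} := [set b | T b < k].

Lemma in_initial T k b : (b \in initial T k) = (T b < k).
Proof. by rewrite inE. Qed.

Lemma entry_onto T (i : 'I_(sumn a)) : exists b, T b = i.
Proof. by case/and4P: (entryP T) => _ /forallP/(_ i)/codomP[b ->] _ _; exists b. Qed.

Lemma initial_geq T k : sumn a <= k -> initial T k = setT.
Proof. by move=> le_k; apply/setP => b; rewrite !inE (leq_trans (ltn_ord _)). Qed.

Lemma card_initial T k : k <= sumn a -> #|initial T k| = k.
Proof.
move=> le_k; rewrite -(card_in_imset (f := T)); last by move=> ? ? _ _; exact: entry_inj.
have -> : [set T b | b in initial T k] = [set i : 'I_(sumn a) | i < k].
  apply/setP => i; rewrite inE; apply/imsetP/idP => [[b + ->]|lti]; first by rewrite inE.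
  by have [b eb] := entry_onto T i; exists b; rewrite // inE eb.
by rewrite cardsE -sum1_card (big_ord_narrow le_k) sum1_card card_ord.
Qed.

Lemma initial_ideal T k : ideal (initial T k).
Proof.
apply/forall_inP => b; rewrite inE => ltb; apply/forallP => c; apply/implyP => le_cb.
by rewrite inE (leq_ltn_trans (entry_mono T le_cb)).
Qed.

Lemma initial_add T b k : T b = k :> nat -> initial T k.+1 = b |: initial T k.
Proof.
move=> eb; apply/setP => c; rewrite in_setU1 !in_initial ltnS leq_eqVlt; congr orb.
apply/eqP/eqP => [eqc|->]; last by rewrite eb.
by apply: (@entry_inj a T); apply: val_inj; rewrite /= eb.
Qed.

(** The boxes with entry less than [k] are reached from the empty diagram by
    adding the boxes in the order of their entries. *)
Lemma initial_diagram T k : exists y, cells a y = initial T k.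
Proof.
elim: k => [|k [y cy]].
  by exists \bot%O; apply/setP => b; rewrite !inE /in_diagram nth_nil ltn0.
have [lek|ltk] := leqP (sumn a) k.
  by exists y; rewrite cy !initial_geq // leqW.
have [b eb] := entry_onto T (Ordinal ltk).
have eqI : b |: cells a y = initial T k.+1 by rewrite cy (@initial_add T b) ?eb.
have [||y' cy' _] := @cells_add a y b; last by exists y'; rewrite cy'.
  by rewrite cy inE eb /= ltnn.
by rewrite eqI initial_ideal.
Qed.

(** The initial diagrams of [T], without naming the bound on the entries: the only
    candidate for it is the number of boxes. *)
Definition tableau_chain T : {set young_itv a} :=
  [set y : young_itv a | cells a y == initial T #|cells a y|].

Lemma tableau_chainP T y :
  reflect (cells a y = initial T #|cells a y|) (y \in tableau_chain T).
Proof. by rewrite inE; exact: eqP. Qed.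

Lemma mem_tableau_chain T y k : cells a y = initial T k -> y \in tableau_chain T.
Proof.
move=> cy; apply/tableau_chainP; rewrite [in RHS]cy.
case: (leqP k (sumn a)) => [lek|/ltnW lek]; first by rewrite card_initial.
by rewrite cy (initial_geq _ lek) cardsT card_box initial_geq.
Qed.

Lemma tableau_chain_card_inj T y z :
  y \in tableau_chain T -> z \in tableau_chain T -> #|cells a y| = #|cells a z| -> y = z.
Proof.
by move=> /tableau_chainP cy /tableau_chainP cz eqc; apply: cells_inj; rewrite /= cy cz eqc.
Qed.

Lemma initial_subset T k l : k <= l -> initial T k \subset initial T l.
Proof. by move=> lekl; apply/subsetP => b; rewrite !inE => /leq_trans; apply. Qed.

Lemma tableau_chain_le T y z : y \in tableau_chain T -> z \in tableau_chain T ->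
  (y <= z)%O = (#|cells a y| <= #|cells a z|).
Proof.
move=> /tableau_chainP cy /tableau_chainP cz; rewrite le_cells.
apply/idP/idP => [/subset_leq_card // | ]; rewrite {2}cy {2}cz; exact: initial_subset.
Qed.

Lemma tableau_chain_chain T : chain (tableau_chain T).
Proof.
apply/forall_inP => y yT; apply/forall_inP => z zT.
by rewrite /Order.comparable !(tableau_chain_le (T := T)) // leq_total.
Qed.

(** A chain through all the initial diagrams contains nothing else, because a
    diagram comparable to the set of boxes with entry less than [T b], for each
    of its boxes [b], is closed under passing to smaller entries. *)
Lemma comparable_tableau_chain T y :
  {in tableau_chain T, forall z, (z >=< y)%O} -> y \in tableau_chain T.
Proof.
move=> cmp.
have lower b c : b \in cells a y -> T c <= T b -> c \in cells a y.
  move=> by_; rewrite leq_eqVlt => /predU1P[/val_inj/entry_inj -> //|ltcb].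
  have [z cz] := initial_diagram T (T b).
  have /orP[] := cmp z (mem_tableau_chain cz); rewrite le_cells cz => /subsetP sub.
    by apply: sub; rewrite inE.
  by have := sub b by_; rewrite inE ltnn.
have [k suby mink] : exists2 k, cells a y \subset initial T k
    & forall l, cells a y \subset initial T l -> k <= l.
  have exk : exists k, cells a y \subset initial T k.
    by exists (sumn a); rewrite initial_geq // subsetT.
  by case: (ex_minnP exk) => k; exists k.
apply: (@mem_tableau_chain T y k); apply/eqP; rewrite eqEsubset suby /=.
case: k suby mink => [|k] suby mink; first by apply/subsetP => b; rewrite inE.
have /subsetPn[b by_] : ~~ (cells a y \subset initial T k).
  by apply/negP => /mink; rewrite ltnn.
rewrite inE -leqNgt => lekb; apply/subsetP => c; rewrite inE ltnS => lec.
by apply: lower by_ _; exact: leq_trans lekb.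
Qed.

Lemma tableau_chain_max T : maxchain \bot%O \top%O (tableau_chain T).
Proof.
apply/maxsetP; split=> [|m /andP[/forall_inP ch _] sub].
  by rewrite tableau_chain_chain; apply/subsetP => y _; rewrite inE le0x lex1.
apply/eqP; rewrite eqEsubset sub andbT; apply/subsetP => y ym.
apply: comparable_tableau_chain => z zT.
by have /forall_inP := ch z (subsetP sub z zT); apply.
Qed.

Definition chain_of_tableau T : max_chains (young_itv a) :=
  exist _ (tableau_chain T) (tableau_chain_max T).

Lemma chain_of_tableau_inj : injective chain_of_tableau.
Proof.
move=> Q T [eqQT]; apply/val_inj/ffunP => b; apply/val_inj => /=.
have agree k : k <= sumn a -> (Q b < k) = (T b < k).
  move=> lek; have [y cy] := initial_diagram Q k.
  have : y \in tableau_chain T by rewrite -eqQT; exact: mem_tableau_chain cy.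
  move=> /tableau_chainP; rewrite cy card_initial // => /setP/(_ b).
  by rewrite !inE.
apply/anti_leq/andP; split; last by rewrite leqNgt agree ?ltnn // ltnW.
by rewrite -ltnS agree // ?ltnSn.
Qed.

Lemma cells_bot : cells a (\bot%O : young_itv a) = set0.
Proof. by apply/setP => b; rewrite !inE /in_diagram nth_nil ltn0. Qed.

Lemma cells_top : cells a (\top%O : young_itv a) = setT.
Proof. by apply/setP => b; rewrite !inE /in_diagram col_lt. Qed.

Lemma covers_path_size x s : path covers x s ->
  #|cells a (last x s)| = #|cells a x| + size s.
Proof.
elim: s x => [|z s IHs] x /=; first by rewrite addn0.
move=> /andP[xz /IHs ->]; have [b bx ->] := covers_add (row_tableau a) xz.
by rewrite cardsU1 bx add1n addSnnS.
Qed.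

(** A saturated chain adds one box at a time, so two boxes cannot arrive together. *)
Lemma covers_path_separates x s b c : path covers x s -> b != c ->
  b \notin cells a x -> c \notin cells a x -> b \in cells a (last x s) ->
  exists2 z, z \in s & (b \in cells a z) != (c \in cells a z).
Proof.
elim: s x => [|z s IHs] x /=; first by move=> _ _ /negPf ->.
move=> /andP[xz zs] neq bx cx bl; have [e ex cz] := covers_add (row_tableau a) xz.
have inz g : g \notin cells a x -> (g \in cells a z) = (g == e).
  by move=> /negPf gx; rewrite cz in_setU1 gx orbF.
have [sep|same] := boolP ((b \in cells a z) != (c \in cells a z)).
  by exists z; rewrite ?mem_head.
have [bz cz'] : b \notin cells a z /\ c \notin cells a z.
  move: same; rewrite negbK !inz //; case: (b =P e) => [eb|_]; last by move=> /eqP <-.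
  by move=> /eqP/esym/eqP ec; rewrite eb ec eqxx in neq.
have [w ws sepw] := IHs z zs neq bz cz' bl.
by exists w; rewrite // inE ws orbT.
Qed.

Section TableauOfChain.
Variables (m : {set young_itv a}) (max_m : maxchain \bot%O \top%O m).

(* The number of diagrams in [m] that miss [b] is the time of arrival of [b],
   counted from 1 since the empty diagram is one of them. *)
Let misses b := [set y : young_itv a in m | b \notin cells a y].

Lemma maxchain_comparable : {in m &, forall y z, (y >=< z)%O}.
Proof.
by move=> y z ym; case/maxsetP: max_m => /andP[/forall_inP/(_ y ym)/forall_inP ch _] _ /ch.
Qed.

(** In a chain, a diagram with [b] and without [c] contains every diagram that
    misses [b], so these miss [c] too. *)
Lemma misses_proper b c y : y \in m -> b \in cells a y -> c \notin cells a y ->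
  misses b \proper misses c.
Proof.
move=> ym by_ cy; apply/properP; split; last first.
  by exists y; rewrite in_set ym ?cy // by_.
apply/subsetP => z; rewrite in_set => /andP[zm bz]; rewrite in_set zm /=.
have /orP[] := maxchain_comparable ym zm; rewrite le_cells => /subsetP sub.
  by rewrite sub in bz.
by apply: contra cy; exact: sub.
Qed.

Lemma card_maxchain : #|m| = (sumn a).+1.
Proof.
have [s [ps ls ->]] := maxchain_path (le0x \top%O) max_m.
have us : uniq (\bot%O :: s) by apply: (sorted_uniq lt_trans ltxx); exact: covers_path_lt.
rewrite cardsE (card_uniqP us) /=; congr S.
by have := covers_path_size ps; rewrite ls cells_top cells_bot cards0 cardsT card_box.
Qed.

Lemma maxchain_separates b c : b != c ->
  exists2 y, y \in m & (b \in cells a y) != (c \in cells a y).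
Proof.
have [s [ps ls ->]] := maxchain_path (le0x \top%O) max_m => neq.
have [|||z zs sep] := covers_path_separates ps neq; rewrite ?cells_bot ?inE //.
  by rewrite ls /in_diagram col_lt.
by exists z; rewrite // !inE zs orbT.
Qed.

Lemma card_misses b : 0 < #|misses b| <= sumn a.
Proof.
have bot_m : \bot%O \in m /\ \top%O \in m.
  have [s [ps ls ->]] := maxchain_path (le0x \top%O) max_m.
  by rewrite !in_set mem_head -ls mem_last.
apply/andP; split.
  by apply/card_gt0P; exists \bot%O; rewrite in_set cells_bot in_set0 bot_m.1.
rewrite -ltnS -card_maxchain; apply: proper_card; apply/properP; split.
  by apply/subsetP => y; rewrite in_set => /andP[].
by exists \top%O; rewrite ?bot_m.2 // in_set cells_top in_setT andbF.
Qed.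

Lemma arrival_lt b : #|misses b|.-1 < sumn a.
Proof. by have := card_misses b; lia. Qed.

Let arrival : {ffun box a -> 'I_(sumn a)} := [ffun b => Ordinal (arrival_lt b)].

Lemma arrival_mono y b c : y \in m -> b \in cells a y -> c \notin cells a y ->
  arrival b < arrival c.
Proof.
move=> ym by_ cy; have /andP[pos _] := card_misses b.
by rewrite !ffunE /= ltn_predRL prednK // proper_card // (misses_proper ym).
Qed.

Lemma arrival_box_lt b c : b != c -> box_le b c -> arrival b < arrival c.
Proof.
move=> neq le_bc; have [y ym] := maxchain_separates neq.
have down : c \in cells a y -> b \in cells a y.
  move=> cy; have /forall_inP/(_ c cy)/forallP/(_ b) := cells_ideal y.
  by rewrite le_bc.
case: (boolP (c \in _)) down => [cy /(_ isT) ->//|cy _].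
by case: (boolP (b \in _)) => // by_ _; exact: arrival_mono ym by_ cy.
Qed.

Lemma arrival_standard : standard arrival.
Proof.
apply: standardI => [b c eqbc|b c eqr ltc|b c eqc ltr].
- apply/eqP; apply: contraT => neq; have [y ym] := maxchain_separates neq.
  case: (boolP (b \in _)) => by_; case: (boolP (c \in _)) => cy // _.
    by have := arrival_mono ym by_ cy; rewrite eqbc ltnn.
  by have := arrival_mono ym cy by_; rewrite eqbc ltnn.
- apply: arrival_box_lt; last by rewrite /box_le eqr leqnn ltnW.
  by apply: contraTneq ltc => ->; rewrite ltnn.
- apply: arrival_box_lt; last by rewrite /box_le eqc leqnn ltnW.
  by apply: contraTneq ltr => ->; rewrite ltnn.
Qed.

(** Arrival times are increasing along [m], so each diagram of [m] is comparable
    to the initial diagrams of the arrival tableau. The chain of this tableau then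
    contains [m], and [m] is maximal. *)
Lemma maxchain_tableau : exists T, tableau_chain T = m.
Proof.
exists (StdTableau arrival_standard).
case/maxsetP: (max_m) => _; apply.
  by rewrite tableau_chain_chain; apply/subsetP => y _; rewrite inE le0x lex1.
apply/subsetP => y ym; apply: comparable_tableau_chain => z /tableau_chainP cz.
rewrite /Order.comparable !le_cells.
case: (boolP (_ \subset _)) => //= /subsetPn[b bz bny].
apply/subsetP => c cy; move: bz; rewrite cz !inE => /= ltb.
by apply: leq_trans ltb; apply: leqW; exact: arrival_mono ym cy bny.
Qed.

End TableauOfChain.

Lemma chain_of_tableau_bij : bijective chain_of_tableau.
Proof.
have inv (m : max_chains (young_itv a)) : exists T, chain_of_tableau T == m.
  by have [T eqT] := maxchain_tableau (valP m); exists T; apply/eqP/val_inj.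
exists (fun m : max_chains (young_itv a) => xchoose (inv m)) => [T|m]; last exact/eqP/(xchooseP (inv m)).
by apply: chain_of_tableau_inj; exact/eqP/(xchooseP (inv (chain_of_tableau T))).
Qed.

(** * Polygon moves and tableau swaps *)

Lemma initial_fresh T b k : T b = k :> nat -> b \notin initial T k.
Proof. by rewrite in_initial => ->; rewrite ltnn. Qed.

Lemma initial_swap Q T (i j : 'I_(sumn a)) k : j = i.+1 :> nat ->
  entry T = [ffun b => tperm i j (Q b)] -> k != j -> initial T k = initial Q k.
Proof.
move=> eqj eqT neqk; apply/setP => b; rewrite !in_initial eqT ffunE.
by case: tpermP => [->|->|//]; rewrite !ltnNge; lia.
Qed.

Lemma tableau_chain_agree Q T k : (forall l, l != k -> initial T l = initial Q l) ->
  forall w, #|cells a w| != k -> (w \in tableau_chain T) = (w \in tableau_chain Q).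
Proof. by move=> agree w neq; rewrite !inE agree. Qed.

Lemma tableau_chain_itv2 T k x y z : k.+2 <= sumn a -> cells a x = initial T k ->
  cells a y = initial T k.+1 -> cells a z = initial T k.+2 ->
  tableau_chain T :&: itv x z = [set x; y; z].
Proof.
move=> lek cx cy cz.
have [xT yT zT] : [/\ x \in tableau_chain T, y \in tableau_chain T & z \in tableau_chain T].
  split; [exact: mem_tableau_chain cx | exact: mem_tableau_chain cy|].
  exact: mem_tableau_chain cz.
have sx : #|cells a x| = k by rewrite cx card_initial // ltnW // ltnW.
have sy : #|cells a y| = k.+1 by rewrite cy card_initial // ltnW.
have sz : #|cells a z| = k.+2 by rewrite cz card_initial.
apply/setP => w; rewrite 2!in_setU !in_set1 in_setI [w \in itv _ _]inE.
apply/andP/idP => [[wT]|].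
  rewrite !(tableau_chain_le (T := T)) // sx sz => /andP[ge le].
  have : [|| #|cells a w| == k, #|cells a w| == k.+1 | #|cells a w| == k.+2].
    by move: (#|cells a w|) ge le => r ge le; lia.
  rewrite -{1}sx -sz -sy => /or3P[] /eqP eqs;
    by rewrite (tableau_chain_card_inj wT _ eqs) // eqxx ?orbT.
move=> /orP[/orP[]|] /eqP->; rewrite !(tableau_chain_le (T := T)) // ?sx ?sy ?sz;
  lia.
Qed.

Lemma row_entry_row b c : row b < row c -> row_tableau a b < row_tableau a c.
Proof. exact: row_filling_row. Qed.

Lemma row_entry_col b c : row b = row c -> col b < col c -> row_tableau a b < row_tableau a c.
Proof. exact: row_filling_col. Qed.

(** With [b] and [c] in one row, [R b < R c] puts [b] left of [c], against
    [T c < T b]; this is where [T] being standard excludes the descents of the row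
    tableau that are not between two rows. *)
Lemma row_descent T b c : row_tableau a b < row_tableau a c -> T c < T b -> row b < row c.
Proof.
move=> ltR ltT; case: (ltngtP (row b) (row c)) => // [/row_entry_row|eqr]; first by lia.
case: (ltngtP (col b) (col c)) => [ltc|ltc|eqc].
- by have := entry_row T eqr ltc; lia.
- by have := row_entry_col (esym eqr) ltc; lia.
- by move: ltT; rewrite (box_inj eqr eqc) ltnn.
Qed.

Lemma left_step_polygon Q T : left_step Q T ->
  polygon_move (tableau_EL (row_tableau a)) (chain_of_tableau Q) (chain_of_tableau T).
Proof.
move=> /existsP[i /existsP[j /and3P[/eqP eqj /eqP eqT]]].
move=> /existsP[b /existsP[c /and3P[/eqP Qb /eqP Qc ltr]]].
have agree (l : nat) : l != j -> initial T l = initial Q l by exact: initial_swap eqj eqT.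
have lej : i.+2 <= sumn a by rewrite -eqj; exact: ltn_ord.
have Qb' : Q b = i :> nat by rewrite Qb.
have Qc' : Q c = i.+1 :> nat by rewrite Qc.
have Tb : T b = i.+1 :> nat by rewrite eqT ffunE Qb tpermL.
have Tc : T c = i :> nat by rewrite eqT ffunE Qc tpermR.
(* The chains share [x] and [z]; in between, [Q] passes through [y'] and [T]
   through [y]. *)
have [x cx] := initial_diagram Q i; have [z cz] := initial_diagram Q i.+2.
have [y cy] := initial_diagram T i.+1; have [y' cy'] := initial_diagram Q i.+1.
have cxT : cells a x = initial T i by rewrite agree // eqj neq_ltn ltnSn.
have czT : cells a z = initial T i.+2 by rewrite agree // eqj neq_ltn ltnSn orbT.
have xy : cells a y = c |: cells a x by rewrite cy cxT; exact: initial_add.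
have yz : cells a z = b |: cells a y by rewrite cy czT; exact: initial_add.
have xy' : cells a y' = b |: cells a x by rewrite cy' cx; exact: initial_add.
have y'z : cells a z = c |: cells a y' by rewrite cy' cz; exact: initial_add.
have c_x : c \notin cells a x by rewrite cxT; exact: initial_fresh.
have b_y : b \notin cells a y by rewrite cy; exact: initial_fresh.
have b_x : b \notin cells a x by rewrite cx; exact: initial_fresh.
have c_y' : c \notin cells a y' by rewrite cy'; exact: initial_fresh.
have [covxy covyz] := (add_covers c_x xy, add_covers b_y yz).
have [covxy' covy'z] := (add_covers b_x xy', add_covers c_y' y'z).
have sx : #|cells a x| = i by rewrite cx card_initial // ltnW // ltnW.
have sz : #|cells a z| = i.+2 by rewrite cz card_initial.
have same (w : young_itv a) : #|cells a w| != j -> (w \in tableau_chain Q) = (w \in tableau_chain T).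
  by move=> neq; rewrite (tableau_chain_agree agree).
have ltR : row_tableau a b < row_tableau a c by exact: row_entry_row.
have eqQ : tableau_chain Q :&: itv x z = [set w in [:: x; y'; z]].
  rewrite (tableau_chain_itv2 lej cx cy' cz); apply/setP => w.
  by rewrite !in_setU !in_set1 in_set !in_cons orbF orbA.
have pathQ : path covers x [:: y'; z] by rewrite /= covxy' covy'z.
apply/existsP; exists x; apply/existsP; exists y; apply/existsP; exists z.
rewrite /=; apply/and5P; split; last (apply/and5P; split; last (apply/andP; split)).
- exact: lt_trans (covers_lt covxy) (covers_lt covyz).
- by rewrite in_setI !(mem_tableau_chain cx) (mem_tableau_chain cxT).
- by rewrite in_setI !(mem_tableau_chain cz) (mem_tableau_chain czT).
- apply/eqP/setP => w; rewrite [LHS]in_set [RHS]in_set.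
  case lewx : (w <= x)%O; rewrite ?andbF // same //.
  by rewrite neq_ltn eqj -sx ltnS subset_leq_card // -le_cells.
- apply/eqP/setP => w; rewrite [LHS]in_set [RHS]in_set.
  case lezw : (z <= w)%O; rewrite ?andbF // same //.
  by rewrite neq_ltn eqj -sz orbC subset_leq_card // -le_cells.
- by rewrite (tableau_chain_itv2 lej cxT cy czT).
- rewrite /descent covxy covyz /= (label_add _ c_x xy) (label_add _ b_y yz).
  by rewrite leEnat ltnS -ltnNge.
- apply/tableau_chainP => eqy; move: b_y; rewrite eqy in_initial Qb'.
  by rewrite cy card_initial ?ltnSn // ltnW.
- by rewrite eqQ; exact: (path_maxchain pathQ).
rewrite eqQ /ascending label_seq_path //= (label_add _ b_x xy') (label_add _ c_y' y'z).
by rewrite andbT leEnat ltnS ltnW.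
Qed.

Lemma polygon_left_step Q T :
  polygon_move (tableau_EL (row_tableau a)) (chain_of_tableau Q) (chain_of_tableau T) ->
  left_step Q T.
Proof.
move=> /existsP[x /existsP[y /existsP[z /=]]]; rewrite !in_setI.
case/and5P=> _ /andP[xQ xT] /andP[zQ zT] /eqP below.
case/and5P=> /eqP above /eqP eqT /and3P[covxy covyz desc] yQ _.
have yT : y \in tableau_chain T.
  have : y \in [set x; y; z] by rewrite !in_setU !in_set1 eqxx orbT.
  by rewrite -eqT in_setI => /andP[].
have [c c_x xy] := covers_add (row_tableau a) covxy.
have [b b_y yz] := covers_add (row_tableau a) covyz.
pose k := #|cells a x|.
have sy : #|cells a y| = k.+1 by rewrite xy cardsU1 c_x add1n.
have sz : #|cells a z| = k.+2 by rewrite yz cardsU1 b_y sy add1n.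
have lek : k.+2 <= sumn a by rewrite -sz -card_box max_card.
move: (xQ) (xT) (yT) (zQ) (zT) => /tableau_chainP cxQ /tableau_chainP cxT.
move=> /tableau_chainP cyT /tableau_chainP czQ /tableau_chainP czT.
rewrite -/k ?sy ?sz in cxQ cxT cyT czQ czT.
have c_y : c \in cells a y by rewrite xy setU11.
have b_x : b \notin cells a x by apply: contra b_y; rewrite xy in_setU1 orbC => ->.
have b_z : b \in cells a z by rewrite yz setU11.
have c_z : c \in cells a z by rewrite yz in_setU1 c_y orbT.
have Tc : T c = k :> nat.
  by move: c_x c_y; rewrite cxT cyT !in_initial -leqNgt; clear; lia.
have Tb : T b = k.+1 :> nat.
  by move: b_y b_z; rewrite cyT czT !in_initial -leqNgt; clear; lia.
(* Since [y] is missing from the chain of [Q], the box [c] is not the first one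
   that [Q] adds to [x]. *)
have Qc : Q c = k.+1 :> nat.
  have neq : Q c != k :> nat.
    apply: contra yQ => /eqP eqc; apply: (@mem_tableau_chain Q y k.+1).
    by rewrite xy (initial_add eqc) -cxQ.
  by move: c_x c_z neq; rewrite cxQ czQ !in_initial -leqNgt; clear; lia.
have Qb : Q b = k :> nat.
  have neq : Q b != k.+1 :> nat.
    by apply/eqP; rewrite -Qc => /val_inj/entry_inj eqbc; move: Tb; rewrite eqbc Tc => /eqP; rewrite eqn_leq ltnn andbF.
  by move: b_x b_z neq; rewrite cxQ czQ !in_initial -leqNgt; clear; lia.
(* Only the diagram with [k.+1] boxes changes: the smaller ones are below [x] and
   the larger ones above [z], where the two chains coincide. *)
have agree l : l <= sumn a -> l != k.+1 -> initial T l = initial Q l.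
  move=> lel neq; have [w cw] := initial_diagram Q l.
  have wQ := mem_tableau_chain cw; have sw : #|cells a w| = l by rewrite cw card_initial.
  suff /tableau_chainP : w \in tableau_chain T by rewrite sw cw => <-.
  move: neq; rewrite neq_ltn ltnS => /orP[le|ge].
    have : w \in chain_below (tableau_chain Q) x.
      by rewrite in_set wQ (tableau_chain_le wQ xQ) sw.
    by rewrite below in_set => /andP[].
  have : w \in chain_above (tableau_chain Q) z.
    by rewrite in_set wQ (tableau_chain_le zQ wQ) sw sz.
  by rewrite above in_set => /andP[].
apply/existsP; exists (Q b); apply/existsP; exists (Q c); apply/and3P; split.
- by rewrite Qb Qc.
- apply/eqP/ffunP => e; rewrite ffunE; apply/val_inj.
  case: tpermP => [/entry_inj->|/entry_inj->|neqb neqc] /=; rewrite ?Tb ?Tc ?Qb ?Qc //.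
  have ne : (Q e != k :> nat) && (Q e != k.+1 :> nat).
    by rewrite -Qc -Qb; apply/andP; split; apply/eqP => /val_inj.
  case/andP: ne => nek nek1.
  have /setP/(_ e) := agree (Q e) (ltnW (ltn_ord _)) nek1.
  have /setP/(_ e) := agree (Q e).+1 (ltn_ord _) nek.
  rewrite !in_initial ltnSn ltnn => le /negbT; rewrite -leqNgt => ge.
  by apply/anti_leq/andP; split.
- apply/existsP; exists b; apply/existsP; exists c; rewrite !eqxx /=.
  apply: (@row_descent T); last by rewrite Tb Tc.
  move: desc; rewrite /= (label_add _ c_x xy) (label_add _ b_y yz).
  by rewrite leEnat ltnS -ltnNge.
Qed.

End TableauChains.

(** * Left weak order and generalized quotients *)

(* The name [pcomp] also denotes the composition of partial functions. *)
Local Notation pcomp := Defs.pcomp.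

Section WeakOrder.
Variable n : nat.
Implicit Types (u v w r : 'S_n) (V : {set 'S_n}).

Lemma length_pcomp_le w v : perm_length (pcomp w v) <= perm_length w + perm_length v.
Proof.
rewrite !perm_lengthE card_inv_pcomp (card_invV v).
by apply: leq_add; apply: subset_leq_card; exact: subsetDl.
Qed.

Lemma simple_reflP r :
  reflect (exists i j : 'I_n, j = i.+1 :> nat /\ r = tperm i j) (r \in simple_refl n).
Proof.
rewrite inE; apply: (iffP existsP) => [[i /existsP[j /andP[/eqP eqj /eqP ->]]]|[i [j [eqj ->]]]].
  by exists i, j.
by exists i; apply/existsP; exists j; rewrite eqj !eqxx.
Qed.

Lemma length_simple r : r \in simple_refl n -> perm_length r <= 1.
Proof. by move=> rS; rewrite perm_lengthE; apply: inv_set_bound; rewrite expg1. Qed.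

Lemma length_tperm_up w (i j : 'I_n) : j = i.+1 :> nat ->
  (perm_length (pcomp (tperm i j) w) == (perm_length w).+1) = ((w^-1)%g i < (w^-1)%g j).
Proof.
move=> eqj; rewrite !perm_lengthE /pcomp.
have [lt|gt|/val_inj/perm_inj eqij] := ltngtP ((w^-1)%g i) ((w^-1)%g j).
- by rewrite inv_set_tperm ?eqxx.
- by rewrite (inv_set_tperm_desc eqj gt); lia.
- by move: eqj; rewrite eqij; lia.
Qed.

(** If [w v] were shorter than [w] and [v] together, then [r w v] would be shorter
    than [r w] and [v], because [r] increases the length of [w v] by at most one
    and that of [w] by exactly one. *)
Lemma quotient_by_down V w r : r \in simple_refl n ->
  perm_length (pcomp r w) = (perm_length w).+1 ->
  pcomp r w \in quotient_by V -> w \in quotient_by V.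
Proof.
move=> rS len; rewrite !inE => /forall_inP quo; apply/forall_inP => v vV.
have := quo v vV; rewrite len.
have -> : pcomp (pcomp r w) v = pcomp r (pcomp w v) by rewrite /pcomp mulgA.
have := length_pcomp_le r (pcomp w v); have := length_simple rS.
have := length_pcomp_le w v; lia.
Qed.

Lemma left_weak_refl u : left_weak u u.
Proof. by exists [::]; split=> // j /andP[/leq_trans/[apply]]. Qed.

Lemma left_weak_step u w r : left_weak u w -> r \in simple_refl n ->
  perm_length (pcomp r w) = (perm_length w).+1 -> left_weak u (pcomp r w).
Proof.
move=> [s [sS eqw lens]] rS len; exists (rcons s r); split.
- by move=> x; rewrite mem_rcons inE => /predU1P[->|/sS].
- by rewrite /left_mult_word foldl_rcons -/(left_mult_word u s) -eqw.
move=> j; rewrite size_rcons [j <= _]leq_eqVlt ltnS => /andP[j1 /predU1P[->|lej]].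
  rewrite take_oversize ?size_rcons // /left_mult_word foldl_rcons.
  rewrite -/(left_mult_word u s) -eqw len addnS; congr S.
  case: s {sS} eqw lens => [-> _|x s -> /(_ (size (x :: s)))]; first by rewrite addn0.
  by rewrite take_size; apply; rewrite leqnn.
by rewrite -cats1 takel_cat // lens // j1.
Qed.

(** The length condition on prefixes says that each letter adds one to the length;
    this form removes the words from later inductions. *)
Lemma left_weak_ind u (P : 'S_n -> Prop) : P u ->
  (forall w r, P w -> r \in simple_refl n -> perm_length (pcomp r w) = (perm_length w).+1 ->
     P (pcomp r w)) ->
  forall w, left_weak u w -> P w.
Proof.
move=> Pu Pstep w [s [sS -> lens]] {w}; elim/last_ind: s sS lens => [//|s r IHs] sS lens.
have lens' j : 1 <= j <= size s ->
    perm_length (left_mult_word u (take j s)) = perm_length u + j.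
  move=> /andP[j1 lej]; rewrite -lens ?size_rcons ?j1 ?leqW //.
  by rewrite -cats1 takel_cat.
rewrite /left_mult_word foldl_rcons -/(left_mult_word u s); apply: Pstep.
- by apply: IHs => // x xs; apply: sS; rewrite mem_rcons inE xs orbT.
- by apply: sS; rewrite mem_rcons mem_head.
have := lens (size s).+1; rewrite size_rcons leqnn take_oversize ?size_rcons // => /(_ isT).
rewrite /left_mult_word foldl_rcons -/(left_mult_word u s) => ->; rewrite addnS; congr S.
case: s {IHs sS lens} lens' => [_|x s /(_ (size (x :: s)))]; first by rewrite addn0.
by rewrite take_size leqnn => ->.
Qed.

End WeakOrder.

(** * Row words *)

Section RowWords.
Variable a : young.
Implicit Types (b c : box a) (Q T : std_tableau a).

Lemma row_wordE T b : row_word T (row_filling a b) = T b.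
Proof. by rewrite permE; congr (T _); apply: row_filling_inj; rewrite row_readingK. Qed.

Lemma row_word_inv T b : ((row_word T)^-1)%g (T b) = row_filling a b.
Proof. by rewrite -row_wordE permK. Qed.

Lemma row_word_inj : injective (@row_word a).
Proof. by move=> Q T eqw; apply/val_inj/ffunP => b; rewrite -!row_wordE eqw. Qed.

(** Both conditions compare, in reading order, the positions [b] and [c] of [i] and
    [i + 1] in [Q]; that [T] is standard excludes that they are in one row. *)
Lemma left_stepP Q T : reflect
  (exists r, [/\ r \in simple_refl (sumn a), row_word T = pcomp r (row_word Q)
     & perm_length (pcomp r (row_word Q)) = (perm_length (row_word Q)).+1])
  (left_step Q T).
Proof.
apply: (iffP idP).
  move=> /existsP[i /existsP[j /and3P[/eqP eqj /eqP eqT]]].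
  move=> /existsP[b /existsP[c /and3P[/eqP Qb /eqP Qc ltr]]].
  exists (tperm i j); split; first by apply/simple_reflP; exists i, j.
    by apply/permP => p; rewrite permM -(row_readingK p) !row_wordE eqT ffunE.
  by apply/eqP; rewrite length_tperm_up // -Qb -Qc !row_word_inv; exact: row_filling_row.
case=> _ [/simple_reflP[i [j [eqj ->]]] eqT /eqP].
have [[b eb] [c ec]] := (entry_onto Q i, entry_onto Q j).
rewrite length_tperm_up // -eb -ec !row_word_inv => ltR.
have TE e : T e = tperm i j (Q e) by rewrite -!row_wordE eqT permM.
apply/existsP; exists i; apply/existsP; exists j; rewrite eqj eqxx /=; apply/andP; split.
  by apply/eqP/ffunP => e; rewrite ffunE TE.
apply/existsP; exists b; apply/existsP; exists c; rewrite eb ec !eqxx /=.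
by apply: (@row_descent a T) ltR _; rewrite !TE eb ec tpermL tpermR eqj.
Qed.

(** As the row words are closed downwards, a weak order chain that ends in a row
    word consists of row words only, and each of its steps is a left step. *)
Lemma left_order_weak Q T : left_order Q T <-> left_weak (row_word Q) (row_word T).
Proof.
split=> [/connectP[p pQ ->]|].
  elim/last_ind: p pQ => [|p S IHp] /=; first by move=> _; exact: left_weak_refl.
  rewrite rcons_path last_rcons => /andP[/IHp le_p /left_stepP[r [rS -> len]]].
  exact: left_weak_step.
move=> le_QT; move: {2}(row_word T) (erefl (row_word T)) => w eqw.
rewrite eqw in le_QT; move: T eqw; elim/left_weak_ind: le_QT => [T /row_word_inj->|]; first exact: connect0.
move=> {}w r IHw rS len T eqT; have [V eqV] := row_words_quotient a.
have /imsetP[S _ eqS] : w \in row_words a.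
  by rewrite eqV; apply: quotient_by_down rS len _; rewrite -eqV -eqT imset_f.
apply: connect_trans (IHw S (esym eqS)) (connect1 _); apply/left_stepP.
by exists r; rewrite -eqS.
Qed.

End RowWords.

(** * The isomorphisms *)

Section RelIsomorphic.
Variables (A B C : Type) (rA : A -> A -> Prop) (rB : B -> B -> Prop) (rC : C -> C -> Prop).

Lemma rel_isomorphic_sym : rel_isomorphic rA rB -> rel_isomorphic rB rA.
Proof.
by move=> [f [g fK gK] hf]; exists g => [|x y]; [exists f | rewrite hf !gK].
Qed.

Lemma rel_isomorphic_trans :
  rel_isomorphic rA rB -> rel_isomorphic rB rC -> rel_isomorphic rA rC.
Proof.
move=> [f bf hf] [g bg hg]; exists (g \o f) => [|x y]; first exact: bij_comp.
by rewrite hf hg.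
Qed.

End RelIsomorphic.

Lemma connect_isomorphic (S T : finType) (e : rel S) (e' : rel T) (f : S -> T) :
  bijective f -> (forall x y, e x y = e' (f x) (f y)) ->
  rel_isomorphic (fun x y => connect e x y : Prop) (fun x y => connect e' x y).
Proof.
move=> bf eqe; exists f => // x y; have [g fK gK] := bf; split=> /connectP[p].
  move=> xp ->; apply/connectP; exists (map f p); last by rewrite last_map.
  by rewrite path_map; apply: sub_path xp => u v; rewrite /= -eqe.
move=> xp eqy; apply/connectP; exists (map g p); last by rewrite -{1}(fK x) last_map -eqy fK.
by rewrite -{1}(fK x) path_map; apply: sub_path xp => u v; rewrite /= eqe !gK.
Qed.

Section Isomorphisms.
Variable a : young.

Lemma left_order_mcd_order :
  rel_isomorphic (@left_order a) (mcd_order (tableau_EL (row_tableau a))).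
Proof.
apply: (connect_isomorphic (f := @chain_of_tableau a)) => [|Q T].
  exact: chain_of_tableau_bij.
apply/idP/idP; [exact: left_step_polygon | exact: polygon_left_step].
Qed.

Lemma left_order_weak_order :
  rel_isomorphic (@left_order a) (@weak_order (sumn a) (row_word_quotient a)).
Proof.
pose f T : {x | x \in quotient_set (row_word_quotient a)} :=
  exist _ (row_word T) (imset_f _ isT).
have surj (w : {x | x \in quotient_set (row_word_quotient a)}) : exists T, f T == w.
  by have /imsetP[T _ eqT] := valP w; exists T; apply/eqP/val_inj.
have injf : injective f by move=> Q T [/row_word_inj].
exists f => [|Q T]; last exact: left_order_weak.
exists (fun w => xchoose (surj w)) => [T|w]; last exact/eqP/(xchooseP (surj w)).
by apply: injf; exact/eqP/(xchooseP (surj (f T))).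
Qed.

End Isomorphisms.

Theorem theorem6p16 (a : young) :
  rel_isomorphic (mcd_order (tableau_EL (row_tableau a))) (@left_order a) /\
  rel_isomorphic (mcd_order (tableau_EL (row_tableau a)))
                 (@weak_order (sumn a) (row_word_quotient a)).
Proof.
have iso := rel_isomorphic_sym (left_order_mcd_order a); split=> //.
exact: rel_isomorphic_trans iso (left_order_weak_order a).
Qed.
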